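(* Let $(g,\nabla)$ be a statistical structure on a manifold $M$, let $K=\nabla-\nabla^g$ be its difference tensor, and let $\tilde g$ be the Sasakian metric on $TM$ determined by $g$ and $\nabla$. If $\tilde g$ is flat, then the statistical structure is Hessian, the Riemannian metric $g$ is flat, and $\nabla K=0$. Conversely, if $(g,\nabla)$ is Hessian, $g$ is flat and $\nabla K=0$, then $\tilde g$ is flat.
   Context: All objects are smooth. A statistical structure on a manifold $M$ is a pair $(g,\nabla)$, where $g$ is a (positive definite) Riemannian metric and $\nabla$ is a torsion-free affine connection such that $(\nabla_Xg)(Y,Z)=(\nabla_Yg)(X,Z)$ for all $X,Y,Z$. $\nabla^g$ denotes the Levi-Civita connection of $g$, and $K(X,Y)=K_XY=\nabla_XY-\nabla^g_XY$. The structure is called Hessian if the curvature tensor $R$ of $\nabla$ vanishes. Let $\pi:TM\to M$ be the tangent bundle. For $\xi,X\in T_pM$: the vertical lift $X^v_\xi\in T_\xi TM$ is the velocity at $t=0$ of the curve $t\mapsto \xi+tX$; the horizontal lift $X^h_\xi\in T_\xi TM$ is the velocity at $t=0$ of the curve $t\mapsto\xi_t$ obtained by $\nabla$-parallel transport of $\xi$ along the $\nabla$-geodesic with initial velocity $X$. One has $T_\xi TM=\{X^v_\xi\}\oplus\{X^h_\xi\}$, both lifts being linear and injective in $X$. The Sasakian metric $\tilde g$ determined by $g$ and $\nabla$ is the Riemannian metric on $TM$ with $\tilde g(X^v,Y^v)=g(X,Y)=\tilde g(X^h,Y^h)$ and $\tilde g(X^v,Y^h)=0$. *)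

(* Defs.v *)
From HB Require Import structures.
From mathcomp Require Import all_boot all_order all_algebra.
From mathcomp Require Import all_classical all_reals all_analysis.
Set Implicit Arguments.
Unset Strict Implicit.
Unset Printing Implicit Defensive.
Import Order.TTheory GRing.Theory Num.Theory.
Import numFieldNormedType.Exports.
Local Open Scope classical_set_scope.
Local Open Scope ring_scope.

Section Smoothness.
Context {R : realType}.
Implicit Types V W : normedModType R.

(* Only used on open [U]; the values of [f] outside [U] are irrelevant
   (lemma [Ck_ext]). *)
Fixpoint Ck V W (k : nat) (U : set V) (f : V -> W) : Prop :=
  if k is k'.+1 then
    (forall x, U x -> differentiable f x) /\
    (forall v, Ck k' U (fun x => 'd f x v))
  else forall x, U x -> {for x, continuous f}.

Definition smooth_on V W (U : set V) (f : V -> W) : Prop := forall k, Ck k U f.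

Lemma diff_near V W (f g : V -> W) x : (\forall y \near x, f y = g y) ->
  differentiable f x -> differentiable g x /\ 'd g x = 'd f x :> (V -> W).
Proof.
move=> fg df.
have fgx : f x = g x by exact: nbhs_singleton fg.
have cdf : continuous ('d f x) by exact: diff_continuous.
have H : g \o shift x = cst (g x) + 'd f x +o_ 0 id.
  have /eqaddoP e0 := diff_locally df.
  apply/eqaddoP => e e_gt0.
  have fg0 : \forall y \near 0, f (y + x) = g (y + x).
    have := fg; rewrite (near_shift 0 x) subr0.
    by [].
  near=> y.
  have -> : (g \o shift x - (cst (g x) + 'd f x)) y
    = (f \o shift x - (cst (f x) + 'd f x)) y.
    rewrite -fgx; rewrite !fctE /=; congr (_ - _); symmetry.
    by near: y.
  by near: y; exact: e0.
have E := diff_unique cdf H.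
split=> //; apply/diff_locallyP; split; last by rewrite E.
by rewrite E.
Unshelve. all: by end_near. Qed.

Lemma Ck_ext V W k (U : set V) (f g : V -> W) : open U ->
  (forall x, U x -> f x = g x) -> Ck k U f -> Ck k U g.
Proof.
move=> oU; elim: k f g => [|k IH] f g fg /=.
  move=> cf x Ux; rewrite /prop_for /continuous_at -fg //.
  apply: cvg_trans (cf x Ux); apply: near_eq_cvg.
  by near=> y; apply: fg; near: y; exact: open_nbhs_nbhs.
move=> [df dk].
have fgn x : U x -> \forall y \near x, f y = g y.
  by move=> Ux; near=> y; apply: fg; near: y; exact: open_nbhs_nbhs.
split=> [x Ux|v]; first by have [] := diff_near (fgn x Ux) (df x Ux).
apply: IH (dk v) => x Ux.
by have [_ ->] := diff_near (fgn x Ux) (df x Ux).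
Unshelve. all: by end_near. Qed.

Lemma Ck_pred V W k (U : set V) (f : V -> W) : Ck k.+1 U f -> Ck k U f.
Proof.
elim: k f => [|k IH] f.
  by move=> [df _] x Ux; exact: differentiable_continuous (df x Ux).
by move=> [df dk]; split=> // v; exact: IH (dk v).
Qed.

Lemma Ck_sub V W k (U U' : set V) (f : V -> W) : U `<=` U' ->
  Ck k U' f -> Ck k U f.
Proof.
move=> UU'; elim: k f => [|k IH] f /=; first by move=> cf x /UU'; exact: cf.
by move=> [df dk]; split=> [x /UU' /df|v] //; exact: IH (dk v).
Qed.

Lemma Ck_cst V W k (U : set V) (a : W) : Ck k U (fun _ => a).
Proof.
elim: k a => [|k IH] a /=; first by move=> x _; exact: cst_continuous.
split=> [x _|v]; first exact: differentiable_cst.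
have -> : (fun x => 'd (fun=> a) x v) = (fun=> 0) :> (V -> W).
  by apply/funext => x; rewrite (diff_cst a x).
exact: IH.
Qed.

Lemma CkD V W k (U : set V) (f g : V -> W) : open U ->
  Ck k U f -> Ck k U g -> Ck k U (f \+ g).
Proof.
move=> oU; elim: k f g => [|k IH] f g /=.
  by move=> cf cg x Ux; apply: continuousD; [exact: cf|exact: cg].
move=> [df dkf] [dg dkg]; split=> [x Ux|v].
  by apply: differentiableD; [exact: df|exact: dg].
apply: Ck_ext (IH _ _ (dkf v) (dkg v)) => // x Ux.
by rewrite /= diffD //; [exact: df|exact: dg].
Qed.

Lemma Ck_sum V W k (U : set V) m (f : 'I_m -> V -> W) : open U ->
  (forall i, Ck k U (f i)) -> Ck k U (fun x => \sum_(i < m) f i x).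
Proof.
move=> oU Cf.
suff H (s : seq 'I_m) : Ck k U (fun x => \sum_(i <- s) f i x) by exact: H.
elim: s => [|i s IH].
  by apply: Ck_ext (Ck_cst k U 0) => // x _; rewrite big_nil.
by apply: Ck_ext (CkD oU (Cf i) IH) => // x _; rewrite big_cons.
Qed.

Lemma CkM V k (U : set V) (f g : V -> R) : open U ->
  Ck k U f -> Ck k U g -> Ck k U (fun x => f x * g x).
Proof.
move=> oU; elim: k f g => [|k IH] f g.
  by move=> cf cg x Ux; apply: continuousM; [exact: cf|exact: cg].
move=> Cf Cg; have [df dkf] := Cf; have [dg dkg] := Cg.
split=> [x Ux|v].
  by apply: differentiableM; [exact: df|exact: dg].
apply: Ck_ext (CkD oU (IH _ _ (Ck_pred Cf) (dkg v))
                      (IH _ _ (Ck_pred Cg) (dkf v))) => // x Ux.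
by rewrite /= (@diffM _ _ f g) //; [exact: df|exact: dg].
Qed.

Lemma Ck_post V W W' k (U : set V) (f : V -> W) (L : {linear W -> W'}) :
  open U -> continuous L -> Ck k U f -> Ck k U (L \o f).
Proof.
move=> oU cL; elim: k f => [|k IH] f /=.
  by move=> cf x Ux; apply: continuous_comp; [exact: cf|exact: cL].
move=> [df dkf]; split=> [x Ux|v].
  by apply: differentiable_comp; [exact: df|exact: linear_differentiable].
apply: Ck_ext (IH _ (dkf v)) => // x Ux.
by rewrite diff_comp /= ?diff_lin //; [exact: df|exact: linear_differentiable].
Qed.

Lemma Ck_pre V V' W k (U : set V) (f : V -> W) (L : {linear V' -> V}) :
  open U -> continuous L -> Ck k U f -> Ck k (L @^-1` U) (f \o L).
Proof.
move=> oU cL.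
have oLU : open (L @^-1` U) by apply: open_comp => // x _; exact: cL.
elim: k f => [|k IH] f /=.
  by move=> cf x Ux; apply: continuous_comp; [exact: cL|exact: cf].
move=> [df dkf]; split=> [x Ux|v].
  by apply: differentiable_comp; [exact: linear_differentiable|exact: df].
apply: Ck_ext (IH _ (dkf (L v))) => // x Ux.
by rewrite diff_comp /= ?diff_lin //; [exact: linear_differentiable|exact: df].
Qed.

End Smoothness.

(* A smooth manifold modelled on R^n, without separation axioms: a set covered
   by charts [coord i : dom i -> R^n] that are injective, have open overlaps and
   smooth transition maps. [param i] is the inverse of [coord i]; the values of
   [coord i] outside [dom i] and of [param i] outside [coord i @` dom i] are
   junk. The topology is the one for which the charts are homeomorphisms onto
   open sets, see [mopen]. *)
Record atlas (R : realType) (n : nat) := Atlas {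
  point :> Type;
  chart : Type;
  dom : chart -> set point;
  coord : chart -> point -> 'rV[R]_n;
  param : chart -> 'rV[R]_n -> point;
  chart_at : point -> chart;
  chart_atP : forall p, dom (chart_at p) p;
  coordK : forall i p, dom i p -> param i (coord i p) = p;
  open_overlap : forall i j, open (coord i @` (dom i `&` dom j));
  smooth_overlap : forall i j,
    smooth_on (coord i @` (dom i `&` dom j)) (coord j \o param i)
}.

Arguments chart {R n} a.
Arguments dom {R n a} _ _.
Arguments coord {R n a} _ _.
Arguments param {R n a} _ _.
Arguments chart_at {R n a} _.
Arguments chart_atP {R n a} _.
Arguments coordK {R n a} _ _ _.
Arguments open_overlap {R n a} _ _.
Arguments smooth_overlap {R n a} _ _.

Section Tangent.
Context {R : realType} {n : nat} {M : atlas R n}.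
Implicit Types (p : M) (i j : chart M).

Definition mopen (A : set M) : Prop :=
  forall i, open (coord i @` (dom i `&` A)).

Definition trans i j : 'rV[R]_n -> 'rV[R]_n := coord j \o param i.

(* A tangent vector at [p] is the family of its components in all the charts
   around [p], related by the differentials of the transition maps; the
   components in the charts whose domain does not contain [p] are set to 0 so
   that the family is determined by the vector. *)
Definition coherent p : {pred chart M -> 'rV[R]_n} := fun v =>
  `[< (forall i, ~ dom i p -> v i = 0) /\
      (forall i j, dom i p -> dom j p ->
         v j = 'd (trans i j) (coord i p) (v i)) >].

Lemma coherent_submod p : submod_closed (coherent p).
Proof.
split.
  by apply/asboolP; split=> [//|i j _ _]; rewrite /= linear0.
move=> a u v /asboolP[u0 uc] /asboolP[v0 vc]; apply/asboolP; split.
  move=> i Ni; rewrite -[LHS]/(a *: u i + v i).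
  by rewrite u0 // v0 // scaler0 addr0.
move=> i j di dj; rewrite -[LHS]/(a *: u j + v j).
rewrite (uc i j) // (vc i j) //.
by rewrite -[(a *: u + v) i]/(a *: u i + v i) linearP.
Qed.

HB.instance Definition _ p :=
  GRing.isSubmodClosed.Build R (chart M -> 'rV[R]_n) (coherent p)
    (coherent_submod p).

Record tangent p := Tangent {
  comp :> chart M -> 'rV[R]_n;
  comp_coherent : comp \in coherent p
}.

HB.instance Definition _ p := [isSub for @comp p].
HB.instance Definition _ p := [Choice of tangent p by <:].
HB.instance Definition _ p := [SubChoice_isSubLmodule of tangent p by <:].

Lemma trans_in i j p : dom i p -> dom j p -> trans i j (coord i p) = coord j p.
Proof. by move=> di dj; rewrite /trans /= coordK. Qed.

Lemma near_overlap i j p : dom i p -> dom j p ->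
  \forall x \near coord i p, dom i (param i x) /\ dom j (param i x) /\
    coord i (param i x) = x.
Proof.
move=> di dj; have op := open_overlap i j.
have : \forall x \near coord i p, (coord i @` (dom i `&` dom j)) x.
  by apply: open_nbhs_nbhs; split=> //; exists p.
apply: filterS => x [q [qi qj] <-].
by rewrite coordK.
Qed.

Lemma trans_differentiable i j p : dom i p -> dom j p ->
  differentiable (trans i j) (coord i p).
Proof.
by move=> di dj; have [d _] := smooth_overlap i j 1; apply: d; exists p.
Qed.

Lemma diff_transC i j k p : dom i p -> dom j p -> dom k p -> forall v,
  'd (trans j k) (coord j p) ('d (trans i j) (coord i p) v)
  = 'd (trans i k) (coord i p) v.
Proof.
move=> di dj dk v.
have tij := trans_in di dj.
have near_eq : \forall x \near coord i p,
    (trans j k \o trans i j) x = trans i k x.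
  near=> x; rewrite /trans /= coordK //.
  suff [_ [//]] : dom i (param i x) /\ dom j (param i x) /\
    coord i (param i x) = x by [].
  by near: x; exact: near_overlap.
have d1 := trans_differentiable di dj.
have d2 : differentiable (trans j k) (trans i j (coord i p)).
  by rewrite tij; exact: trans_differentiable.
have d12 := differentiable_comp d1 d2.
have [_ E] := diff_near near_eq d12.
transitivity ('d (trans j k \o trans i j) (coord i p) v).
  by rewrite -tij; exact: esym (congr1 (@^~ v) (diff_comp d1 d2)).
exact: esym (congr1 (@^~ v) E).
Unshelve. all: by end_near. Qed.

Lemma diff_transxx i p : dom i p -> forall v,
  'd (trans i i) (coord i p) v = v.
Proof.
move=> di v.
have near_eq : \forall x \near coord i p, id x = trans i i x.
  by apply: filterS (near_overlap di di) => x [_ [_ ]].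
have [_ E] := diff_near near_eq (@ex_diff _ _ _ _ _ _ _ (is_diff_id (coord i p))).
transitivity ('d (@id 'rV[R]_n) (coord i p) v).
  exact: (congr1 (@^~ v) E).
exact: (congr1 (@^~ v) (@diff_val _ _ _ _ _ _ _ (is_diff_id (coord i p)))).
Qed.

Definition chart_tangent_fun i p (v : 'rV[R]_n) : chart M -> 'rV[R]_n :=
  fun j => if `[< dom i p /\ dom j p >] then 'd (trans i j) (coord i p) v else 0.

Lemma chart_tangent_coherent i p v : chart_tangent_fun i p v \in coherent p.
Proof.
apply/asboolP; rewrite /chart_tangent_fun; split=> [j Ndj|j k dj dk].
  by rewrite asboolF // => -[].
have [di|ndi] := pselect (dom i p); last first.
  by rewrite !asboolF ?linear0 // => -[].
rewrite asboolT; last by split.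
rewrite asboolT; last by split.
exact: esym (diff_transC di dj dk v).
Qed.

(* The tangent vector at [p] with components [v] in the chart [i]; it is 0 when
   [p] is not in the domain of [i]. *)
Definition chart_tangent i p v : tangent p :=
  Tangent (chart_tangent_coherent i p v).

Lemma chart_tangentE i p v j : dom i p -> dom j p ->
  chart_tangent i p v j = 'd (trans i j) (coord i p) v.
Proof. by move=> di dj; rewrite /= /chart_tangent_fun asboolT. Qed.

Lemma chart_tangentK i p v : dom i p -> chart_tangent i p v i = v.
Proof. by move=> di; rewrite chart_tangentE //; exact: diff_transxx. Qed.

Lemma tangentK i p (u : tangent p) : dom i p -> chart_tangent i p (u i) = u.
Proof.
move=> di; apply/val_inj/funext => j; rewrite /chart_tangent /=.
have /asboolP[u0 uc] := comp_coherent u; rewrite /chart_tangent_fun.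
have [dj|ndj] := pselect (dom j p).
  by rewrite asboolT // (uc i j).
by rewrite asboolF ?u0 // => -[].
Qed.

End Tangent.
Arguments chart_tangent : simpl never.

Section TangentBundle.
Context {R : realType} {n : nat}.
Variable M : atlas R n.
Implicit Types (i j : chart M).

Definition tb_point : Type := {p : M & tangent p}.
Definition tb_dom i : set tb_point := [set xi | dom i (projT1 xi)].
Definition tb_coord i (xi : tb_point) : 'rV[R]_(n + n) :=
  row_mx (coord i (projT1 xi)) (projT2 xi i).
Definition tb_param i (z : 'rV[R]_(n + n)) : tb_point :=
  existT _ (param i (lsubmx z)) (chart_tangent i (param i (lsubmx z)) (rsubmx z)).

Lemma tb_coordK i xi : tb_dom i xi -> tb_param i (tb_coord i xi) = xi.
Proof.
case: xi => p u /= di; rewrite /tb_param /tb_coord /= row_mxKl row_mxKr.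
by rewrite coordK // tangentK.
Qed.

Lemma tb_overlapE i j :
  tb_coord i @` (tb_dom i `&` tb_dom j) =
  lsubmx @^-1` (coord i @` (dom i `&` dom j)).
Proof.
apply/seteqP; split=> [_ [xi [di dj] <-]|z [p [di dj] pz]] /=.
  by rewrite /tb_coord row_mxKl; exists (projT1 xi).
exists (existT _ p (chart_tangent i p (rsubmx z))) => //.
by rewrite /tb_coord chart_tangentK // pz hsubmxK.
Qed.

Let continuous_lsub : continuous (@lsubmx R 1 n n) := @continuous_lsubmx R 1 n n.
Let continuous_rsub : continuous (@rsubmx R 1 n n) := @continuous_rsubmx R 1 n n.

Lemma tb_open_overlap i j : open (tb_coord i @` (tb_dom i `&` tb_dom j)).
Proof.
rewrite tb_overlapE; apply: open_comp; last exact: open_overlap.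
by move=> z _; exact: continuous_lsub.
Qed.

Lemma Ck_coord (V : normedModType R) k (U : set V) m (f : V -> 'rV[R]_m) a :
  open U -> Ck k U f -> Ck k U (fun x => f x 0 a).
Proof.
move=> oU Cf.
have L_lin : linear (fun N : 'rV[R]_m => N 0 a : R).
  by move=> c u v; rewrite !mxE.
pose L : {linear 'rV[R]_m -> R} :=
  HB.pack (fun N : 'rV[R]_m => N 0 a : R) (GRing.isLinear.Build _ _ _ _ _ L_lin).
have cL : continuous L by exact: coord_continuous.
exact: (Ck_post oU cL Cf).
Qed.

Lemma Ck_scalel (V W : normedModType R) k (U : set V) (f : V -> R) (w : W) :
  open U -> Ck k U f -> Ck k U (fun x => f x *: w).
Proof.
move=> oU Cf.
have L_lin : linear (fun c : R => c *: w).
  by move=> c u v; rewrite scalerDl scalerA.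
pose L : {linear R -> W} :=
  HB.pack (fun c : R => c *: w) (GRing.isLinear.Build _ _ _ _ _ L_lin).
have cL : continuous L by exact: scalel_continuous.
exact: (Ck_post oU cL Cf).
Qed.

Lemma tb_smooth_overlap i j :
  smooth_on (tb_coord i @` (tb_dom i `&` tb_dom j)) (tb_coord j \o tb_param i).
Proof.
move=> k; set U := coord i @` (dom i `&` dom j).
have oU : open U := open_overlap i j.
have oT := @tb_open_overlap i j; rewrite tb_overlapE -/U in oT *.
have Ct m : Ck m U (trans i j) := smooth_overlap i j m.
pose e (a : 'I_n) : 'rV[R]_n := delta_mx 0 a.
have C1 a : Ck k (lsubmx @^-1` U)
    (fun z : 'rV[R]_(n + n) => trans i j (lsubmx z) 0 a).
  apply: Ck_coord => //; exact: (Ck_pre oU continuous_lsub (Ct k)).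
have C2 a b : Ck k (lsubmx @^-1` U)
    (fun z : 'rV[R]_(n + n) => 'd (trans i j) (lsubmx z) (e a) 0 b).
  apply: Ck_coord => //; have [_ d] := Ct k.+1.
  exact: (Ck_pre oU continuous_lsub (d (e a))).
have C3 a : Ck k (lsubmx @^-1` U) (fun z : 'rV[R]_(n + n) => rsubmx z 0 a).
  apply: Ck_coord => //.
  have Cid : Ck k setT (fun x : 'rV[R]_n => x).
    case: (k) => [|m] /=; first by move=> x _.
    split=> // v; apply: Ck_ext (Ck_cst m setT v) => //.
      exact: openT.
    by move=> x _; rewrite (@diff_val _ _ _ _ _ _ _ (is_diff_id x)).
  have := Ck_pre openT continuous_rsub Cid; rewrite preimage_setT => H.
  exact: (Ck_sub (@subsetT _ _) H).
have C : Ck k (lsubmx @^-1` U) (fun z : 'rV[R]_(n + n) =>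
   \sum_a trans i j (lsubmx z) 0 a *: row_mx (e a) 0 +
   \sum_b (\sum_a rsubmx z 0 a * 'd (trans i j) (lsubmx z) (e a) 0 b) *:
             row_mx 0 (e b)).
  apply: CkD => //; apply: Ck_sum => // a; apply: Ck_scalel => //.
  by apply: Ck_sum => // b; exact: CkM.
apply: Ck_ext C => // z [p [di dj] pz].
rewrite -[RHS]/(row_mx (coord j (param i (lsubmx z)))
  (chart_tangent i (param i (lsubmx z)) (rsubmx z) j)).
have ez : param i (lsubmx z) = p by rewrite -pz coordK.
rewrite ez chart_tangentE // -[coord j p](trans_in di dj) pz.
have diff_sum : 'd (trans i j) (lsubmx z) (rsubmx z)
    = \sum_a rsubmx z 0 a *: 'd (trans i j) (lsubmx z) (e a).
  rewrite [in LHS](row_sum_delta (rsubmx z)) linear_sum.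
  by apply: eq_bigr => a _; rewrite linearZ.
rewrite diff_sum; move: (trans i j (lsubmx z)) => y.
have row_mxL (u : 'rV[R]_n) : row_mx u 0 = \sum_a u 0 a *: row_mx (e a) 0 :> 'rV[R]_(n + n).
  rewrite [in LHS](row_sum_delta u).
  apply/rowP => c; rewrite summxE; case: (split_ordP c) => d ->.
    rewrite row_mxEl summxE; apply: eq_bigr => a _.
    by rewrite [RHS]mxE row_mxEl mxE.
  by rewrite row_mxEr mxE big1 // => a _; rewrite mxE row_mxEr mxE mulr0.
have row_mxR (u : 'rV[R]_n) : row_mx 0 u = \sum_a u 0 a *: row_mx 0 (e a) :> 'rV[R]_(n + n).
  rewrite [in LHS](row_sum_delta u).
  apply/rowP => c; rewrite summxE; case: (split_ordP c) => d ->.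
    by rewrite row_mxEl mxE big1 // => a _; rewrite mxE row_mxEl mxE mulr0.
  rewrite row_mxEr summxE; apply: eq_bigr => a _.
  by rewrite [RHS]mxE row_mxEr mxE.
rewrite -row_mxL.
set w := \sum_a _ *: 'd _ _ _.
transitivity (row_mx y 0 + row_mx 0 w); last first.
  by rewrite add_row_mx addr0 add0r.
congr (_ + _); rewrite row_mxR; apply: eq_bigr => b _; congr (_ *: _).
by rewrite /w summxE; apply: eq_bigr => a _; rewrite [RHS]mxE.
Qed.

Definition tangent_bundle : atlas R (n + n) :=
  {| point := tb_point; chart := chart M;
     dom := tb_dom; coord := tb_coord; param := tb_param;
     chart_at := fun xi => chart_at (projT1 xi);
     chart_atP := fun xi => chart_atP (projT1 xi);
     coordK := tb_coordK;
     open_overlap := tb_open_overlap;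
     smooth_overlap := tb_smooth_overlap |}.

End TangentBundle.

Section Calculus.
Context {R : realType} {n : nat}.
Variable M : atlas R n.
Implicit Types (p : M) (A B : set M) (f : M -> R).

Definition hausdorff : Prop := forall p q, p <> q ->
  exists A B, [/\ mopen A, mopen B, A p, B q & A `&` B = set0].

Definition second_countable : Prop := exists B : nat -> set M,
  (forall k, mopen (B k)) /\
  (forall A p, mopen A -> A p -> exists k, B k p /\ B k `<=` A).

(* Locally defined functions and vector fields are total ones, with arbitrary
   values outside the open set on which they are required to be smooth. *)
Definition vfield : Type := forall p, tangent p.

Definition smooth_fun A f : Prop :=
  forall i, smooth_on (coord i @` (dom i `&` A)) (f \o param i).

Definition smooth_vfield A (X : vfield) : Prop :=
  forall i, smooth_on (coord i @` (dom i `&` A)) (fun x => X (param i x) i).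

(* The derivative of [f] in the direction [u], computed in the preferred chart
   at [p]; by the chain rule every chart around [p] gives the same value. *)
Definition vderive p (u : tangent p) f : R :=
  'd (f \o param (chart_at p)) (coord (chart_at p) p) (u (chart_at p)).

(* [W] is the Lie bracket [X, Y] on [A]. *)
Definition lie_bracket A (X Y W : vfield) : Prop :=
  forall B f, mopen B -> B `<=` A -> smooth_fun B f -> forall p, B p ->
    vderive (W p) f = vderive (X p) (fun q => vderive (Y q) f)
                      - vderive (Y p) (fun q => vderive (X q) f).

Record metric := Metric {
  inner :> forall p, tangent p -> tangent p -> R;
  inner_sym : forall p (u v : tangent p), inner u v = inner v u;
  inner_linear : forall p a (u v w : tangent p),
    inner (a *: u + v) w = a * inner u w + inner v w;
  inner_gt0 : forall p (u : tangent p), u != 0 -> 0 < inner u u;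
  inner_smooth : forall A X Y, mopen A -> smooth_vfield A X ->
    smooth_vfield A Y -> smooth_fun A (fun p => inner (X p) (Y p))
}.

(* [cov D u Y] is the covariant derivative of [Y] in the direction [u] at [p],
   for [Y] smooth near [p]. That it only depends on the germ of [Y] at [p]
   follows from [cov_leibniz] applied to indicator functions of open sets. *)
Record connection := Connection {
  cov :> forall p, tangent p -> vfield -> tangent p;
  cov_linear : forall A Y p a (u v : tangent p), mopen A -> A p ->
    smooth_vfield A Y -> cov (a *: u + v) Y = a *: cov u Y + cov v Y;
  cov_add : forall A Y Z p (u : tangent p), mopen A -> A p ->
    smooth_vfield A Y -> smooth_vfield A Z ->
    cov u (fun q => Y q + Z q) = cov u Y + cov u Z;
  cov_leibniz : forall A f Y p (u : tangent p), mopen A -> A p ->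
    smooth_fun A f -> smooth_vfield A Y ->
    cov u (fun q => f q *: Y q) = vderive u f *: Y p + f p *: cov u Y;
  cov_smooth : forall A X Y, mopen A -> smooth_vfield A X ->
    smooth_vfield A Y -> smooth_vfield A (fun p => cov (X p) Y)
}.

Definition nabla (D : connection) (X Y : vfield) : vfield :=
  fun p => D p (X p) Y.

Definition torsion_free (D : connection) : Prop :=
  forall A X Y, mopen A -> smooth_vfield A X -> smooth_vfield A Y ->
    lie_bracket A X Y (fun p => nabla D X Y p - nabla D Y X p).

(* The curvature R(X, Y)Z = D_X D_Y Z - D_Y D_X Z - D_[X, Y] Z vanishes. *)
Definition flat (D : connection) : Prop :=
  forall A X Y Z W, mopen A -> smooth_vfield A X -> smooth_vfield A Y ->
    smooth_vfield A Z -> lie_bracket A X Y W -> forall p, A p ->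
    nabla D X (nabla D Y Z) p - nabla D Y (nabla D X Z) p - nabla D W Z p = 0.

(* (D_X g)(Y, Z) *)
Definition nabla_metric (D : connection) (g : metric) (X Y Z : vfield) p : R :=
  vderive (X p) (fun q => g q (Y q) (Z q))
  - g p (nabla D X Y p) (Z p) - g p (Y p) (nabla D X Z p).

Definition levi_civita (g : metric) (D : connection) : Prop :=
  torsion_free D /\
  forall A X Y Z, mopen A -> smooth_vfield A X -> smooth_vfield A Y ->
    smooth_vfield A Z -> forall p, A p -> nabla_metric D g X Y Z p = 0.

Definition statistical (g : metric) (D : connection) : Prop :=
  torsion_free D /\
  forall A X Y Z, mopen A -> smooth_vfield A X -> smooth_vfield A Y ->
    smooth_vfield A Z -> forall p, A p ->
    nabla_metric D g X Y Z p = nabla_metric D g Y X Z p.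

Definition hessian (g : metric) (D : connection) : Prop :=
  statistical g D /\ flat D.

Definition difference_tensor (D D' : connection) (X Y : vfield) : vfield :=
  fun p => nabla D X Y p - nabla D' X Y p.

(* (D_X K)(Y, Z) = D_X (K(Y, Z)) - K(D_X Y, Z) - K(Y, D_X Z) vanishes. *)
Definition parallel_tensor (D : connection)
    (K : vfield -> vfield -> vfield) : Prop :=
  forall A X Y Z, mopen A -> smooth_vfield A X -> smooth_vfield A Y ->
    smooth_vfield A Z -> forall p, A p ->
    nabla D X (K Y Z) p - K (nabla D X Y) Z p - K Y (nabla D X Z) p = 0.

(* The curve [c] passes through [p] at time [t] with velocity [u]. *)
Definition has_velocity (c : R -> M) (t : R) p (u : tangent p) : Prop :=
  c t = p /\
  forall i, dom i p -> (\forall s \near t, dom i (c s)) /\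
                       is_derive t 1 (fun s => coord i (c s)) (u i).

(* The vector field with constant components [v] in the chart [i]. *)
Definition coord_vfield (i : chart M) (v : 'rV[R]_n) : vfield :=
  fun p => chart_tangent i p v.

(* [V] is parallel along the curve [c] with velocity [dc], for times in [I].
   If V = sum_a V^a E_a in the coordinate frame E_a of a chart, the covariant
   derivative of V along c is sum_a ((V^a)' E_a + V^a D_c' E_a). *)
Definition parallel_along (D : connection) (I : set R) (c : R -> M)
    (dc V : forall t, tangent (c t)) : Prop :=
  forall t i, I t -> dom i (c t) ->
    is_derive t 1 (fun s => V s i) (- D (c t) (dc t) (coord_vfield i (V t i)) i).

Definition geodesic (D : connection) (I : set R) (c : R -> M)
    (dc : forall t, tangent (c t)) : Prop :=
  (forall t, I t -> has_velocity c t (dc t)) /\ parallel_along D I dc dc.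

End Calculus.

Record manifold (R : realType) (n : nat) := Manifold {
  manifold_atlas :> atlas R n;
  manifold_hausdorff : hausdorff manifold_atlas;
  manifold_second_countable : second_countable manifold_atlas
}.

Section Sasaki.
Context {R : realType} {n : nat}.
Variable M : atlas R n.
Implicit Types (g : metric M) (D : connection M).

Definition tpoint (p : M) (u : tangent p) : tangent_bundle M := existT _ p u.

Definition is_vertical_lift (p : M) (xi X : tangent p)
    (w : tangent (tpoint xi)) : Prop :=
  has_velocity (fun t : R => tpoint (xi + t *: X)) 0 w.

(* [dc 0] and [X] (and [V 0] and [xi]) live in the spaces tangent at [c 0] and
   at [p], so that their equality is stated in the tangent bundle. *)
Definition is_horizontal_lift D (p : M) (xi X : tangent p)
    (w : tangent (tpoint xi)) : Prop :=
  exists (e : R) (c : R -> M) (dc V : forall t, tangent (c t)),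
    let I := [set t : R | `|t| < e] in
    [/\ 0 < e, geodesic D I dc /\ tpoint (dc 0) = tpoint X,
        parallel_along D I dc V, tpoint (V 0) = tpoint xi
      & has_velocity (fun t => tpoint (V t)) 0 w].

Definition sasakian g D (gt : metric (tangent_bundle M)) : Prop :=
  exists vl hl : forall p (xi X : tangent p), tangent (tpoint xi),
    (forall p (xi X : tangent p), is_vertical_lift X (vl p xi X)) /\
    (forall p (xi X : tangent p), is_horizontal_lift D X (hl p xi X)) /\
    (forall p (xi X Y : tangent p),
       [/\ gt _ (vl p xi X) (vl p xi Y) = g p X Y,
           gt _ (hl p xi X) (hl p xi Y) = g p X Y
         & gt _ (vl p xi X) (hl p xi Y) = 0]).

End Sasaki.

(* Main.v *)
From HB Require Import structures.
From mathcomp Require Import all_boot all_order all_algebra.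
From mathcomp Require Import all_classical all_reals all_analysis.
From mathcomp Require Import ring lra.
Require Import Defs.
Set Implicit Arguments.
Unset Strict Implicit.
Unset Printing Implicit Defensive.
Import Order.TTheory GRing.Theory Num.Theory.
Import numFieldNormedType.Exports.
Local Open Scope classical_set_scope.
Local Open Scope ring_scope.

(** Everything is local, so the statement can be read in a chart of [M] with
    coordinates [x], and in the chart that it induces on the tangent bundle, with
    coordinates [z = (x, y)]. The connections [D], [Dg] and the metric become
    fields [Gam], [Gamg], [g] of bilinear maps, and [K = Gam - Gamg] is the
    difference tensor. Write [R], [Rg] for the curvatures of [D], [Dg].

    A tangent vector [(a, al)] at [z] has horizontal part [a] and vertical part
    [al + Gam x a y]. In the moving frame given by these two parts the Sasakian
    metric is the direct sum of two copies of [g]. Koszul's formula in this frame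
    ([koszul_v], [koszul_h]) shows that the connection form of its Levi-Civita
    connection sends the direction with parts [(b, be)] and the vector with parts
    [(p, q)] to
<<
      vertical:    Gamg b q - K be p - R(b, p) y / 2
      horizontal:  Gamg b p + K be q + (terms that are linear in R(., .) y)
>>
    and the second structure equation ([frame_curvature]) turns this into the
    curvature of the tangent bundle.

    If that curvature vanishes, its vertical part is needed on the zero section
    [y = 0] only, where the unknown horizontal terms are absent. Two vertical
    directions give [K_a K_b = K_b K_a]; two horizontal ones give [Rg = 0]; a
    horizontal and a vertical one give [R(a, p) b / 2 = (D_a K)(b, p)]. In the last
    equation the left side is antisymmetric in [a, p] and the right side is
    symmetric in [b, p]; a trilinear map with both symmetries is zero, so [R = 0]
    and [D K = 0].

    If conversely [R = 0], [Rg = 0] and [D K = 0], then the connection form is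
    explicit at every [z]: in the complex notation [p + i q] it is the operator
    [Gamg b - i K be]. Comparing [R] with [Rg] gives [K_a K_b = K_b K_a], and the
    curvature is a combination of the four tensors that are now known to vanish
    ([parallel_curvature]).

    The passage between tensors on [M] and their coefficients in a chart is done
    by [curvature_in_chart], [parallel_tensor_in_chart] and [sasakian_in_chart]. *)

(** * Linear and bilinear maps *)

Section LinearFunctions.
Context {R : realType}.

Definition to_linear (V W : lmodType R) (f : V -> W) (Lf : linear f) :
  {linear V -> W} := HB.pack f (GRing.isLinear.Build _ _ _ _ _ Lf).

Section Basics.
Context {V W : lmodType R} {f : V -> W} (Lf : linear f).
Let L := to_linear Lf.

Lemma lin0 : f 0 = 0. Proof. exact: (linear0 L). Qed.
Lemma linD u v : f (u + v) = f u + f v. Proof. exact: (linearD L). Qed.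
Lemma linN u : f (- u) = - f u. Proof. exact: (linearN L). Qed.
Lemma linB u v : f (u - v) = f u - f v. Proof. exact: (linearB L). Qed.
Lemma linZ a u : f (a *: u) = a *: f u. Proof. exact: (linearZZ L). Qed.
Lemma lin_sum I (r : seq I) (F : I -> V) :
  f (\sum_(i <- r) F i) = \sum_(i <- r) f (F i).
Proof. exact: (linear_sum L). Qed.
End Basics.

Definition basis m (a : 'I_m) : 'rV[R]_m := delta_mx 0 a.

Lemma rV_basis m (u : 'rV[R]_m) : u = \sum_a u 0 a *: basis a.
Proof. exact: row_sum_delta. Qed.

Lemma lin_basis m (W : lmodType R) (f : 'rV[R]_m -> W) u : linear f ->
  f u = \sum_a u 0 a *: f (basis a).
Proof.
move=> Lf; rewrite [in LHS](rV_basis u) (lin_sum Lf).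
by apply: eq_bigr => a _; rewrite (linZ Lf).
Qed.

Definition bilin (V V' W : lmodType R) (B : V -> V' -> W) : Prop :=
  (forall v, linear (B ^~ v)) /\ (forall u, linear (B u)).

End LinearFunctions.

(** * Directional derivatives *)

Section DirectionalDerivative.
Context {R : realType}.
Implicit Types V W : normedModType R.

Lemma coord_linear m (j : 'I_m) : linear (fun u : 'rV[R]_m => u 0 j : R).
Proof. by move=> c u v; rewrite !mxE. Qed.

Lemma lsub_linear m k : linear (@lsubmx R 1 m k).
Proof. by move=> c u v; rewrite linearP. Qed.

Lemma rsub_linear m k : linear (@rsubmx R 1 m k).
Proof. by move=> c u v; rewrite linearP. Qed.

(** Keeping differentiability together with the value of the derivative lets the
    rules of differentiation be chained without side conditions. *)
Definition dder V W (f : V -> W) (x w : V) (d : W) : Prop :=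
  differentiable f x /\ 'd f x w = d.

Lemma dderE V W (f : V -> W) x w d : dder f x w d -> 'd f x w = d.
Proof. by case. Qed.

Lemma dder_unique V W (f : V -> W) x w d e : dder f x w d -> dder f x w e ->
  d = e.
Proof. by move=> [_ <-] [_ <-]. Qed.

Lemma dder_diff V W (f : V -> W) x w : differentiable f x ->
  dder f x w ('d f x w).
Proof. by []. Qed.

Lemma dder_eq V W (f : V -> W) x w d d' : dder f x w d -> d = d' ->
  dder f x w d'.
Proof. by move=> H <-. Qed.

Lemma dder_near V W (f g : V -> W) x w d : (\forall y \near x, f y = g y) ->
  dder f x w d -> dder g x w d.
Proof.
by move=> fg [df <-]; have [dg E] := diff_near fg df; split=> //; rewrite E.
Qed.

Lemma dder_cst V W (a : W) (x w : V) : dder (fun=> a) x w 0.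
Proof. by split; [exact: differentiable_cst | rewrite (diff_cst a x)]. Qed.

Lemma dderD V W (f g : V -> W) x w d e : dder f x w d -> dder g x w e ->
  dder (fun y => f y + g y) x w (d + e).
Proof.
move=> [df <-] [dg <-]; split; first exact: differentiableD.
exact: (congr1 (@^~ w) (diffD df dg)).
Qed.

Lemma dderN V W (f : V -> W) x w d : dder f x w d ->
  dder (fun y => - f y) x w (- d).
Proof.
move=> [df <-]; split; first exact: differentiableN.
exact: (congr1 (@^~ w) (diffN df)).
Qed.

Lemma dderB V W (f g : V -> W) x w d e : dder f x w d -> dder g x w e ->
  dder (fun y => f y - g y) x w (d - e).
Proof. by move=> Hf Hg; exact: dderD Hf (dderN Hg). Qed.

Lemma dder_sum V W m (f : 'I_m -> V -> W) x w d :
  (forall i, dder (f i) x w (d i)) ->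
  dder (fun y => \sum_i f i y) x w (\sum_i d i).
Proof.
move=> H.
suff K (s : seq 'I_m) : dder (fun y => \sum_(i <- s) f i y) x w
    (\sum_(i <- s) d i) by exact: K.
elim: s => [|i s IH].
  have -> : (fun y => \sum_(i <- [::]) f i y) = (fun=> 0).
    by apply/funext => y; rewrite big_nil.
  by rewrite big_nil; exact: dder_cst.
have -> : (fun y => \sum_(i <- i :: s) f i y)
    = (fun y => f i y + \sum_(i <- s) f i y).
  by apply/funext => y; rewrite big_cons.
by rewrite big_cons; exact: dderD.
Qed.

Lemma dder_comp V V' W (f : V -> V') (h : V' -> W) x w d :
  dder f x w d -> differentiable h (f x) ->
  dder (fun y => h (f y)) x w ('d h (f x) d).
Proof.
move=> [df <-] dh; split; first exact: differentiable_comp.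
exact: (congr1 (@^~ w) (diff_comp df dh)).
Qed.

Lemma dder_clinear V W (L : V -> W) x w : linear L -> continuous L ->
  dder L x w (L w).
Proof.
move=> LL cL; split.
  exact: (@linear_differentiable _ _ _ (to_linear LL) x cL).
exact: (congr1 (@^~ w) (@diff_lin _ _ _ (to_linear LL) x cL)).
Qed.

Lemma scale_bilinear W : bilinear_for
  (GRing.Scale.Law.clone _ _ *:%R _) (GRing.Scale.Law.clone _ _ *:%R _)
  (fun (a : R) (v : W) => a *: v).
Proof.
split=> [u'|u] a x y /=; first by rewrite scalerDl scalerA.
by rewrite scalerDr !scalerA mulrC.
Qed.

Lemma dderZ V W (f : V -> R) (g : V -> W) x w d e :
  dder f x w d -> dder g x w e ->
  dder (fun y => f y *: g y) x w (d *: g x + f x *: e).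
Proof.
move=> [df <-] [dg <-].
pose B : {bilinear R -> W -> W} := HB.pack (fun (a : R) (v : W) => a *: v)
  (bilinear_isBilinear.Build R R W W _ _ (fun (a : R) (v : W) => a *: v)
     (@scale_bilinear W)).
have cB : continuous (fun p : R * W => B p.1 p.2) by exact: scale_continuous.
have dB := @differentiable_bilin _ _ _ _ B (f x, g x) cB.
have dp := differentiable_pair df dg.
split; first exact: (differentiable_comp dp dB).
transitivity ('d (fun p : R * W => B p.1 p.2) (f x, g x)
               ('d (fun y => (f y, g y)) x w)).
  exact: (congr1 (@^~ w) (diff_comp dp dB)).
rewrite (congr1 (@^~ _) (diff_bilin (f x, g x) cB)).
by rewrite (congr1 (@^~ w) (diff_pair df dg)) /= addrC.
Qed.

Lemma dder_id V (x w : V) : dder (fun y => y) x w w.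
Proof. by apply: (@dder_clinear _ _ (fun y => y)) => // y; exact. Qed.

Lemma dder_coord V m (f : V -> 'rV[R]_m) x w d j : dder f x w d ->
  dder (fun y => f y 0 j) x w (d 0 j).
Proof.
move=> Hf.
have cj : continuous (fun u : 'rV[R]_m => u 0 j) by exact: coord_continuous.
have [dj _] := dder_clinear (f x) 0 (coord_linear j) cj.
apply: dder_eq (dder_comp Hf dj) _.
exact: (dderE (dder_clinear _ _ (coord_linear j) cj)).
Qed.

(** Expanding in the standard basis reduces this product rule to the one for a
    scalar times a vector. Linearity is asked only near [x] because the curvature
    is linear in its last argument only on the coordinate domain. *)
Lemma dder_linapp_near V W m (B : V -> 'rV[R]_m -> W) (f : V -> 'rV[R]_m) x w d :
  (\forall y \near x, linear (B y)) -> (forall u, differentiable (B ^~ u) x) ->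
  dder f x w d ->
  dder (fun y => B y (f y)) x w ('d (B ^~ (f x)) x w + B x d).
Proof.
move=> LB dB Hf; have LBx := nbhs_singleton LB.
have EB : \forall y \near x, \sum_a f y 0 a *: B y (basis a) = B y (f y).
  by apply: filterS LB => y LBy; rewrite -lin_basis.
apply: dder_near EB _; apply: dder_eq.
  apply: dder_sum => a; apply: dderZ; first exact: dder_coord Hf.
  exact: dder_diff.
rewrite big_split /= addrC; congr (_ + _); last by rewrite -lin_basis.
have E : \forall y \near x, \sum_a f x 0 a *: B y (basis a) = B y (f x).
  by apply: filterS LB => y LBy; rewrite -lin_basis.
apply/esym/dderE; apply: dder_near E _; apply: dder_sum => a.
apply: dder_eq; first by apply: dderZ; [exact: dder_cst | exact: dder_diff].
by rewrite scale0r add0r.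
Qed.

Lemma dder_linapp V W m (B : V -> 'rV[R]_m -> W) (f : V -> 'rV[R]_m) x w d :
  (forall y, linear (B y)) -> (forall u, differentiable (B ^~ u) x) ->
  dder f x w d ->
  dder (fun y => B y (f y)) x w ('d (B ^~ (f x)) x w + B x d).
Proof. by move=> LB; apply: dder_linapp_near; near=> y; exact: LB.
Unshelve. all: by end_near. Qed.

Lemma dder_lin V m W (L : 'rV[R]_m -> W) (f : V -> 'rV[R]_m) x w d :
  linear L -> dder f x w d -> dder (fun y => L (f y)) x w (L d).
Proof.
move=> LL Hf; apply: dder_eq.
  apply: (dder_linapp (B := fun=> L)) Hf => // u; exact: differentiable_cst.
by rewrite (dderE (dder_cst _ _ _)) add0r.
Qed.

Lemma dder_bilin V m m' W (B : V -> 'rV[R]_m -> 'rV[R]_m' -> W)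
    (f : V -> 'rV[R]_m) (h : V -> 'rV[R]_m') x w d e :
  (forall y, bilin (B y)) -> (forall u v, differentiable (fun y => B y u v) x) ->
  dder f x w d -> dder h x w e ->
  dder (fun y => B y (f y) (h y)) x w
    ('d (fun y => B y (f x) (h x)) x w + B x d (h x) + B x (f x) e).
Proof.
move=> LB dB Hf Hh.
have Hfv v : dder (fun y => B y (f y) v) x w
    ('d (fun y => B y (f x) v) x w + B x d v).
  apply: (dder_linapp (B := fun y u => B y u v)) => //.
  by move=> y; exact: (LB y).1.
apply: dder_eq.
  apply: (dder_linapp (B := fun y v => B y (f y) v)) Hh => [y|v].
    exact: (LB y).2.
  exact: (Hfv v).1.
by rewrite (dderE (Hfv _)).
Qed.

Lemma dder_row V m k (f : V -> 'rV[R]_m) (h : V -> 'rV[R]_k) x w d e :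
  dder f x w d -> dder h x w e ->
  dder (fun y => row_mx (f y) (h y)) x w (row_mx d e).
Proof.
move=> Hf Hh.
have Ll : linear (fun u : 'rV[R]_m => row_mx u (0 : 'rV[R]_k)).
  by move=> c u v; rewrite scale_row_mx add_row_mx scaler0 addr0.
have Lr : linear (fun u : 'rV[R]_k => row_mx (0 : 'rV[R]_m) u).
  by move=> c u v; rewrite scale_row_mx add_row_mx scaler0 addr0.
have E u v : row_mx u v = row_mx u (0 : 'rV[R]_k) + row_mx (0 : 'rV[R]_m) v.
  by rewrite add_row_mx addr0 add0r.
rewrite [X in dder X](_ : _ = fun y => row_mx (f y) 0 + row_mx 0 (h y)).
  by rewrite E; apply: dderD; [exact: dder_lin Ll Hf | exact: dder_lin Lr Hh].
by apply/funext => y; rewrite E.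
Qed.

End DirectionalDerivative.

(** * Symmetry of second derivatives *)

Section Schwarz.
Context {R : realType}.
Implicit Types V W : normedModType R.

Lemma dder_is_derive V W (f : V -> W) x w d : dder f x w d -> is_derive x w f d.
Proof.
by move=> [df <-]; split; [exact: diff_derivable | exact: deriveE].
Qed.

Lemma dder_line V W (f : V -> W) (c u : V) (s : R) : differentiable f (c + s *: u) ->
  dder (fun s : R => f (c + s *: u)) s 1 ('d f (c + s *: u) u).
Proof.
move=> df; apply: (dder_comp (f := fun s : R => c + s *: u)) => //.
apply: dder_eq (dderD (dder_cst c s 1) (dderZ (dder_id s 1) (dder_cst u s 1))) _.
by rewrite add0r scale1r scaler0 addr0.
Qed.

(** Along [u], the mean value theorem turns the second difference into [t] times
    an increment of [fun y => 'd f y u], and the differentiability of that function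
    at [x] evaluates the increment up to [o(t)]. *)
Lemma second_difference V (f : V -> R) (x u v : V) (e : R) :
  (\forall y \near x, differentiable f y) ->
  differentiable (fun y => 'd f y u) x -> 0 < e ->
  exists2 r : R, 0 < r & forall t, 0 < t < r ->
    `|f (x + t *: u + t *: v) - f (x + t *: u) - f (x + t *: v) + f x
      - t ^+ 2 * 'd (fun y => 'd f y u) x v| <= e * t ^+ 2.
Proof.
move=> dfx dfu e0; set F := fun y => 'd f y u; set L := 'd F x.
(* The two points where the derivative along [u] is taken are at distance at most
   [t * (`|u| + `|v|)] and [t * `|u|] from [x]; the sum of the two is below [t * k]. *)
pose k := `|u| + `|u| + `|v| + 1.
have k0 : 0 < k by rewrite ltr_wpDl // !addr_ge0.
have [r0 r0_gt0 Hr0] : exists2 r : R, 0 < r &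
    forall h, `|h| < r -> `|F (h + x) - (F x + L h)| <= e / k * `|h|.
  have /eqaddoP e1 := diff_locally dfu.
  have [r /= rgt0 Hr] := (nbhs_normP _ _).1 (e1 _ (divr_gt0 e0 k0)).
  by exists r => // h hr; apply: Hr; rewrite /ball_ /= sub0r normrN.
have [r1 r1_gt0 Hr1] : exists2 r : R, 0 < r &
    forall h, `|h| < r -> differentiable f (x + h).
  have [r /= rgt0 Hr] := (nbhs_normP _ _).1 dfx.
  exists r => // h hr; apply: Hr.
  by rewrite /ball_ /= opprD addrA subrr sub0r normrN.
exists (Num.min r0 r1 / k); first by rewrite divr_gt0 // lt_min r0_gt0.
move=> t /andP[t0 tr].
have tk : t * k < Num.min r0 r1 by rewrite -ltr_pdivlMr.
have small s a : 0 <= s <= t -> 0 <= a <= t ->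
    `|s *: u + a *: v| <= t * (`|u| + `|v|).
  move=> /andP[s0 st] /andP[a0 at_]; rewrite (le_trans (ler_normD _ _)) //.
  by rewrite !normrZ !ger0_norm // mulrDr lerD // ler_wpM2r.
have small1 s a : 0 <= s <= t -> 0 <= a <= t ->
    `|s *: u + a *: v| < Num.min r0 r1.
  move=> Hs Ha; apply: le_lt_trans (small s a Hs Ha) _; apply: le_lt_trans tk.
  by rewrite ler_wpM2l ?(ltW t0) // /k; have := normr_ge0 u; lra.
have t00 : 0 <= t by exact: ltW.
pose phi s := f (x + t *: v + s *: u) - f (x + s *: u).
pose dphi s := F (x + t *: v + s *: u) - F (x + s *: u).
have Hphi s : 0 <= s <= t -> dder phi s 1 (dphi s).
  move=> Hs; apply: dderB; apply: dder_line.
    rewrite -addrA [t *: v + _]addrC; apply: Hr1.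
    have := small1 s t Hs; rewrite t00 lexx => /(_ isT).
    by rewrite lt_min => /andP[].
  apply: Hr1; have := small1 s 0 Hs; rewrite t00 lexx scale0r addr0 => /(_ isT).
  by rewrite lt_min => /andP[].
have [th tht E] : exists2 c, c \in `]0, t[%R & phi t - phi 0 = dphi c * (t - 0).
  apply: MVT => // [s|].
    rewrite in_itv /= => /andP[s0 st]; apply: dder_is_derive; apply: Hphi.
    by rewrite !ltW.
  apply: continuous_in_subspaceT => s; rewrite inE /= in_itv /= => Hs.
  exact: differentiable_continuous (Hphi s Hs).1.
move: tht; rewrite in_itv /= => /andP[th0 tht].
have Hth : 0 <= th <= t by rewrite !ltW.
have -> : f (x + t *: u + t *: v) - f (x + t *: u) - f (x + t *: v) + f x
    = dphi th * t.
  rewrite -[X in _ * X]subr0 -E /phi !scale0r !addr0 [x + t *: u + _]addrAC.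
  ring.
pose h1 := th *: u + t *: v; pose h2 := th *: u.
have Lh : L h1 - L h2 = t * L v.
  by rewrite /h1 /h2 linearD [L (t *: v)]linearZZ addrAC subrr add0r.
have -> : dphi th * t - t ^+ 2 * L v
    = t * ((F (h1 + x) - (F x + L h1)) - (F (h2 + x) - (F x + L h2))).
  have -> : dphi th = F (h1 + x) - F (h2 + x).
    rewrite /dphi /h1 /h2 [_ + x]addrC [th *: u + x]addrC.
    by rewrite -addrA [t *: v + _]addrC.
  rewrite expr2 -mulrA -Lh; ring.
have n1 : `|h1| <= t * (`|u| + `|v|) by apply: small; rewrite ?t00 ?lexx.
have n2 : `|h2| <= t * `|u|.
  by rewrite normrZ ger0_norm ?(ltW th0) // ler_wpM2r // ltW.
have B1 : `|F (h1 + x) - (F x + L h1)| <= e / k * `|h1|.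
  apply: Hr0; have := small1 th t Hth; rewrite t00 lexx => /(_ isT).
  by rewrite lt_min => /andP[].
have B2 : `|F (h2 + x) - (F x + L h2)| <= e / k * `|h2|.
  apply: Hr0; have := small1 th 0 Hth; rewrite t00 lexx scale0r addr0 => /(_ isT).
  by rewrite lt_min => /andP[].
rewrite normrM ger0_norm // expr2 [e * _]mulrCA ler_wpM2l //.
apply: (le_trans (ler_normB _ _)); apply: (le_trans (lerD B1 B2)).
rewrite -mulrDr -mulrA ler_wpM2l ?(ltW e0) // ler_pdivrMl //.
rewrite (le_trans (lerD n1 n2)) // -mulrDr mulrC ler_wpM2r // /k; lra.
Qed.

(** The second difference is symmetric in [u] and [v], and both mixed derivatives
    are the limit of its quotient by [t ^+ 2]. *)
Lemma diff_symmetric V (f : V -> R) (x u v : V) :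
  (\forall y \near x, differentiable f y) ->
  differentiable (fun y => 'd f y u) x -> differentiable (fun y => 'd f y v) x ->
  'd (fun y => 'd f y u) x v = 'd (fun y => 'd f y v) x u.
Proof.
move=> dfx du dv; apply/eqP; rewrite -subr_eq0 -normr_eq0.
set a := 'd _ x v; set b := 'd _ x u.
rewrite eq_le normr_ge0 andbT; apply/ler_addgt0Pl => e e0; rewrite addr0.
have e2 : 0 < e / 2 by rewrite divr_gt0.
have [r r0 Hr] := second_difference v dfx du e2.
have [s s0 Hs] := second_difference u dfx dv e2.
pose t := Num.min r s / 2.
have m0 : 0 < Num.min r s by rewrite lt_min r0.
have t0 : 0 < t by rewrite divr_gt0.
have tm : t < Num.min r s by rewrite /t ltr_pdivrMr //; lra.
have {}Hr := Hr t; have {}Hs := Hs t; move: tm; rewrite lt_min => /andP[tr ts].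
move: Hr Hs; rewrite t0 tr ts -/a -/b => /(_ isT) Hr /(_ isT).
rewrite [x + t *: v + _]addrAC => Hs.
have t2 : 0 < t ^+ 2 by rewrite exprn_gt0.
rewrite -(ler_pM2l t2); move: Hr Hs; set X := f _.
set Y := f (x + _); set Z := f (x + _) => Hr Hs.
have -> : t ^+ 2 * `|a - b| =
  `|(X - Z - Y + f x - t ^+ 2 * b) - (X - Y - Z + f x - t ^+ 2 * a)|.
  rewrite -[X in X * _ = _](gtr0_norm t2) -normrM; congr `|_|; ring.
apply: (le_trans (ler_normB _ _)); apply: (le_trans (lerD Hs Hr)).
by rewrite -mulrDl -splitr mulrC.
Qed.

End Schwarz.

(** * Calculus of smooth maps *)

Section SmoothCalculus.
Context {R : realType}.
Implicit Types V W : normedModType R.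

Lemma smooth_differentiable V W (U : set V) (f : V -> W) x :
  smooth_on U f -> U x -> differentiable f x.
Proof. by move=> Cf Ux; have [df _] := Cf 1; exact: df. Qed.

Lemma Ck_rV V k (U : set V) m (f : V -> 'rV[R]_m) : open U ->
  (forall j, Ck k U (fun x => f x 0 j)) -> Ck k U f.
Proof.
move=> oU Cf; apply: Ck_ext (Ck_sum oU (fun j => Ck_scalel (basis j) oU (Cf j))) => //.
by move=> x _; rewrite -rV_basis.
Qed.

Lemma Ck_scale V W k (U : set V) (f : V -> R) (g : V -> W) : open U ->
  Ck k U f -> Ck k U g -> Ck k U (fun x => f x *: g x).
Proof.
move=> oU; elim: k f g => [|k IH] f g.
  by move=> cf cg x Ux; apply: continuousZ; [exact: cf|exact: cg].
move=> Cf Cg; have [df dkf] := Cf; have [dg dkg] := Cg.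
have H x v (Ux : U x) := dderZ (dder_diff v (df x Ux)) (dder_diff v (dg x Ux)).
split=> [x Ux|v]; first exact: (H x 0 Ux).1.
have C := CkD oU (IH _ _ (dkf v) (Ck_pred Cg)) (IH _ _ (Ck_pred Cf) (dkg v)).
apply: Ck_ext C => //.
by move=> x Ux; rewrite (dderE (H x v Ux)).
Qed.

Lemma Ck_linapp V W k (U : set V) m (B : V -> 'rV[R]_m -> W) (f : V -> 'rV[R]_m) :
  open U -> (forall x, linear (B x)) -> (forall u, Ck k U (B ^~ u)) ->
  Ck k U f -> Ck k U (fun x => B x (f x)).
Proof.
move=> oU LB CB Cf.
have C := Ck_sum oU (fun a => Ck_scale oU (Ck_coord a oU Cf) (CB (basis a))).
by apply: Ck_ext C => // x _; rewrite -lin_basis.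
Qed.

Lemma Ck_lin V k (U : set V) m W (L : 'rV[R]_m -> W) (f : V -> 'rV[R]_m) :
  open U -> linear L -> Ck k U f -> Ck k U (fun x => L (f x)).
Proof.
by move=> oU LL Cf; apply: (Ck_linapp (B := fun=> L)) => // u; exact: Ck_cst.
Qed.

Lemma CkN V W k (U : set V) (f : V -> W) : open U ->
  Ck k U f -> Ck k U (fun x => - f x).
Proof.
move=> oU Cf; apply: Ck_ext (Ck_scale oU (Ck_cst k U (-1 : R)) Cf) => // x _.
by rewrite scaleN1r.
Qed.

Lemma CkB V W k (U : set V) (f g : V -> W) : open U ->
  Ck k U f -> Ck k U g -> Ck k U (fun x => f x - g x).
Proof. by move=> oU Cf Cg; exact: CkD oU Cf (CkN oU Cg). Qed.

Lemma Ck_id V k (U : set V) : Ck k U (fun x => x).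
Proof.
case: k => [|k]; first by move=> x _.
split=> [x _|v]; first exact: (dder_id x 0).1.
have -> : (fun x => 'd (fun y : V => y) x v) = fun=> v.
  by apply/funext => x; rewrite (dderE (dder_id x v)).
exact: Ck_cst.
Qed.

Lemma Ck_row V k (U : set V) m m' (f : V -> 'rV[R]_m) (h : V -> 'rV[R]_m') :
  open U -> Ck k U f -> Ck k U h -> Ck k U (fun x => row_mx (f x) (h x)).
Proof.
move=> oU Cf Ch; apply: Ck_rV => // j; case: (split_ordP j) => i ->.
  by apply: Ck_ext (Ck_coord i oU Cf) => // x _; rewrite row_mxEl.
by apply: Ck_ext (Ck_coord i oU Ch) => // x _; rewrite row_mxEr.
Qed.

(** By induction: the derivative of the composite is ['d f (h x)], which is a
    composite of lower order, applied to ['d h x v]. *)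
Lemma Ck_comp V W k m (U : set V) (U' : set 'rV[R]_m) (h : V -> 'rV[R]_m)
    (f : 'rV[R]_m -> W) : open U -> (forall x, U x -> U' (h x)) ->
  Ck k U h -> Ck k U' f -> Ck k U (fun x => f (h x)).
Proof.
move=> oU hU; elim: k f h hU => [|k IH] f h hU.
  move=> ch cf x Ux; apply: (@continuous_comp _ _ _ h f); first exact: ch.
  by apply: cf; exact: hU.
move=> Ch Cf; have [dh dkh] := Ch; have [df dkf] := Cf.
have H x v (Ux : U x) := dder_comp (dder_diff v (dh x Ux)) (df _ (hU x Ux)).
split=> [x Ux|v]; first exact: (H x 0 Ux).1.
have C : Ck k U (fun x => 'd f (h x) ('d h x v)).
  apply: (Ck_linapp (B := fun x u => 'd f (h x) u)); last exact: dkh; first by [].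
    by move=> x a u w; rewrite linearP.
  move=> u.
  exact: (IH (fun y => 'd f y u) h hU (Ck_pred Ch) (dkf u)).
by apply: Ck_ext C => // x Ux; rewrite (dderE (H x v Ux)).
Qed.

Lemma smooth_diff V W (U : set V) (f : V -> W) v :
  smooth_on U f -> smooth_on U (fun x => 'd f x v).
Proof. by move=> Cf k; have [_] := Cf k.+1; exact. Qed.

Lemma smooth_diff_symmetric V m (U : set V) (f : V -> 'rV[R]_m) x u v :
  open U -> U x -> smooth_on U f ->
  'd (fun y => 'd f y u) x v = 'd (fun y => 'd f y v) x u.
Proof.
move=> oU Ux Cf.
have nU : \forall y \near x, U y by exact: open_nbhs_nbhs.
have df y (Uy : U y) := smooth_differentiable Cf Uy.
have d2 w := smooth_differentiable (smooth_diff w Cf) Ux.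
apply/rowP => j.
have E y w : U y -> 'd f y w 0 j = 'd (fun z => f z 0 j) y w.
  by move=> Uy; rewrite (dderE (dder_coord j (dder_diff w (df y Uy)))).
have H w w' : dder (fun y => 'd (fun z => f z 0 j) y w) x w'
    ('d (fun y => 'd f y w) x w' 0 j).
  apply: dder_near (dder_coord j (dder_diff w' (d2 w))).
  by apply: filterS nU => y Uy; exact: E.
rewrite -(dderE (H u v)) -(dderE (H v u)); apply: diff_symmetric.
- by apply: filterS nU => y Uy; exact: (dder_coord j (dder_diff 0 (df y Uy))).1.
- exact: (H u 0).1.
- exact: (H v 0).1.
Qed.

End SmoothCalculus.

(** * Connections and moving frames in a coordinate domain *)

Section BilinearTheory.
Context {R : realType} {V V' W : lmodType R} {B : V -> V' -> W} (LB : bilin B).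
Lemma bilinDl u u' v : B (u + u') v = B u v + B u' v.
Proof. exact: (linD (LB.1 v)). Qed.
Lemma bilinDr u v v' : B u (v + v') = B u v + B u v'.
Proof. exact: (linD (LB.2 u)). Qed.
Lemma bilinNl u v : B (- u) v = - B u v.
Proof. exact: (linN (LB.1 v)). Qed.
Lemma bilinNr u v : B u (- v) = - B u v.
Proof. exact: (linN (LB.2 u)). Qed.
Lemma bilinBl u u' v : B (u - u') v = B u v - B u' v.
Proof. exact: (linB (LB.1 v)). Qed.
Lemma bilinBr u v v' : B u (v - v') = B u v - B u v'.
Proof. exact: (linB (LB.2 u)). Qed.
Lemma bilinZl a u v : B (a *: u) v = a *: B u v.
Proof. exact: (linZ (LB.1 v)). Qed.
Lemma bilinZr a u v : B u (a *: v) = a *: B u v.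
Proof. exact: (linZ (LB.2 u)). Qed.
Lemma bilin0l v : B 0 v = 0.
Proof. exact: (lin0 (LB.1 v)). Qed.
Lemma bilin0r u : B u 0 = 0.
Proof. exact: (lin0 (LB.2 u)). Qed.
End BilinearTheory.

(** Bilinearity is asked at every point, also outside [U], so that expanding in a
    basis never depends on the base point. *)
Definition smooth_bilin {R : realType} {m : nat} {W : normedModType R}
    (U : set 'rV[R]_m) (B : 'rV[R]_m -> 'rV[R]_m -> 'rV[R]_m -> W) : Prop :=
  (forall x, bilin (B x)) /\ (forall u v, smooth_on U (fun x => B x u v)).

HB.lock Definition dform {R : realType} {m : nat} {W : normedModType R}
    (B : 'rV[R]_m -> 'rV[R]_m -> 'rV[R]_m -> W) x a b c : W :=
  'd (fun y => B y b c) x a.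

Section Symbols.
Context {R : realType} {m : nat} {W : normedModType R}.
Variables (U : set 'rV[R]_m) (B : 'rV[R]_m -> 'rV[R]_m -> 'rV[R]_m -> W).
Hypothesis sB : smooth_bilin U B.

Lemma smooth_bilin_differentiable x u v : U x -> differentiable (fun y => B y u v) x.
Proof. exact: smooth_differentiable (sB.2 u v). Qed.

Lemma dder_smooth_bilin (V : normedModType R) (phi f h : V -> 'rV[R]_m) z w p' f' h' :
  U (phi z) -> dder phi z w p' -> dder f z w f' -> dder h z w h' ->
  dder (fun t => B (phi t) (f t) (h t)) z w
    (dform B (phi z) p' (f z) (h z) + B (phi z) f' (h z) + B (phi z) (f z) h').
Proof.
move=> Uz Hphi Hf Hh.
have Hc u v : dder (fun t => B (phi t) u v) z w (dform B (phi z) p' u v).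
  rewrite dform.unlock.
  have dB := smooth_bilin_differentiable u v Uz.
  exact: (dder_comp (h := fun y => B y u v)) Hphi dB.
apply: dder_eq.
  apply: (dder_bilin (B := fun t => B (phi t))) Hf Hh => [t|u v].
    exact: sB.1.
  exact: (Hc u v).1.
by rewrite (dderE (Hc _ _)).
Qed.

Lemma dform_linear x b c : linear (fun a => dform B x a b c).
Proof. by move=> k u v; rewrite dform.unlock linearP. Qed.

Lemma dform_bilin x a : U x -> bilin (dform B x a).
Proof.
move=> Ux; rewrite dform.unlock; split=> [c|b] k u v.
  apply: dderE; apply: (dder_near (f := fun y => k *: B y u c + B y v c)).
    by near=> y; rewrite (bilinDl (sB.1 y)) (bilinZl (sB.1 y)).
  apply: dderD; last exact: dder_diff (smooth_bilin_differentiable _ _ Ux).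
  apply: dder_eq.
    exact: dderZ (dder_cst k x a) (dder_diff a (smooth_bilin_differentiable u c Ux)).
  by rewrite scale0r add0r.
apply: dderE; apply: (dder_near (f := fun y => k *: B y b u + B y b v)).
  by near=> y; rewrite (bilinDr (sB.1 y)) (bilinZr (sB.1 y)).
apply: dderD; last exact: dder_diff (smooth_bilin_differentiable _ _ Ux).
apply: dder_eq.
  exact: dderZ (dder_cst k x a) (dder_diff a (smooth_bilin_differentiable b u Ux)).
by rewrite scale0r add0r.
Unshelve. all: by end_near. Qed.

End Symbols.

(** The components of the curvature tensor of the connection with Christoffel
    symbols [G]; coordinate fields commute, hence there is no bracket term. *)
HB.lock Definition curv {R : realType} {m : nat}
    (G : 'rV[R]_m -> 'rV[R]_m -> 'rV[R]_m -> 'rV[R]_m) x a b c : 'rV[R]_m :=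
  dform G x a b c - dform G x b a c + G x a (G x b c) - G x b (G x a c).

(** The connection form of [G] in the moving frame [F] with dual coframe [P]: the
    components in the frame of the covariant derivative along [A] of the field
    [F ^~ w]. *)
HB.lock Definition frame_form {R : realType} {m k : nat}
    (G : 'rV[R]_m -> 'rV[R]_m -> 'rV[R]_m -> 'rV[R]_m)
    (F : 'rV[R]_m -> 'rV[R]_k -> 'rV[R]_m)
    (P : 'rV[R]_m -> 'rV[R]_m -> 'rV[R]_k) z A w : 'rV[R]_k :=
  P z ('d (F ^~ w) z A + G z A (F z w)).

Section MovingFrame.
Context {R : realType} {m k : nat}.
Variables (U : set 'rV[R]_m) (G : 'rV[R]_m -> 'rV[R]_m -> 'rV[R]_m -> 'rV[R]_m).
Variables (F : 'rV[R]_m -> 'rV[R]_k -> 'rV[R]_m).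
Variables (P : 'rV[R]_m -> 'rV[R]_m -> 'rV[R]_k).
Hypotheses (oU : open U) (sG : smooth_bilin U G).
Hypotheses (LF : forall z, linear (F z)) (LP : forall z, linear (P z)).
Hypotheses (sF : forall w, smooth_on U (F ^~ w)).
Hypotheses (sP : forall A, smooth_on U (P ^~ A)).
Hypotheses (FK : forall z A, F z (P z A) = A) (PK : forall z w, P z (F z w) = w).

Local Notation om := (frame_form G F P).

Lemma frame_formE z A w : F z (om z A w) = 'd (F ^~ w) z A + G z A (F z w).
Proof. by rewrite frame_form.unlock FK. Qed.

Lemma frame_form_smooth A w : smooth_on U (fun z => om z A w).
Proof.
rewrite frame_form.unlock => j.
apply: (Ck_linapp (B := P)) => // [B|]; first exact: sP.
apply: (CkD (f := fun z => 'd (F ^~ w) z A)) => //; first exact: smooth_diff.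
apply: (Ck_linapp (B := fun z u => G z A u)) => //; first by move=> z; exact: (sG.1 z).2.
  by move=> u; exact: sG.2.
exact: sF.
Qed.

(** First structure equation. The constant field [B] is [F (P B)], so that both
    sides are the frame components of the covariant derivatives [G z A B] and
    [G z B A]. *)
Lemma frame_form_torsion z A B dA dB : U z -> G z A B = G z B A ->
  dder (P ^~ B) z A dA -> dder (P ^~ A) z B dB ->
  dA + om z A (P z B) = dB + om z B (P z A).
Proof.
move=> Uz sym [_ <-] [_ <-].
have dP X : differentiable (P ^~ X) z by exact: smooth_differentiable.
have dF w : differentiable (F ^~ w) z by exact: smooth_differentiable.
have E X Y : F z ('d (P ^~ Y) z X + om z X (P z Y)) = G z X Y.
  rewrite linD // frame_formE FK.
  have := dder_linapp LF dF (dder_diff X (dP Y)).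
  rewrite [X in dder X](_ : _ = fun=> Y); last by apply/funext => t; rewrite FK.
  move=> /dder_unique /(_ (dder_cst Y z X)) /eqP; rewrite addrC addr_eq0 => /eqP ->.
  by rewrite addrA addNr add0r.
by rewrite -[LHS](PK z) E sym -E PK.
Qed.

(** Second structure equation. Applying the covariant derivative twice to [F ^~ w]
    gives the first derivative of the connection form plus its square on one hand,
    and the coordinate expression of the curvature on the other hand, up to the
    second derivative of [F ^~ w], which is symmetric. *)
Lemma frame_curvature z A B w dA dB : U z ->
  dder (fun z => om z B w) z A dA -> dder (fun z => om z A w) z B dB ->
  P z (curv G z A B (F z w)) =
  dA - dB + om z A (om z B w) - om z B (om z A w).
Proof.
move=> Uz [_ <-] [_ <-].
have dF v : differentiable (F ^~ v) z by exact: smooth_differentiable.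
have dG u v : differentiable (fun y => G y u v) z.
  exact: smooth_differentiable (sG.2 u v) Uz.
pose D2 X Y := 'd (fun y => 'd (F ^~ w) y Y) z X.
have E X Y : F z ('d (fun z => om z Y w) z X + om z X (om z Y w)) =
    D2 X Y + 'd (fun y => G y Y (F z w)) z X
    + G z Y ('d (F ^~ w) z X) + G z X ('d (F ^~ w) z Y) + G z X (G z Y (F z w)).
  have H1 := dder_linapp LF dF
    (dder_diff X (smooth_differentiable (frame_form_smooth Y w) Uz)).
  have H2 : dder (fun y => 'd (F ^~ w) y Y + G y Y (F y w)) z X
      ('d (fun y => 'd (F ^~ w) y Y) z X
        + ('d (fun y => G y Y (F z w)) z X + G z Y ('d (F ^~ w) z X))).
    apply: dderD.
      apply: dder_diff; exact: smooth_differentiable (smooth_diff Y (sF w)) Uz.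
    apply: (dder_linapp (B := fun y u => G y Y u)).
    - by move=> y; exact: (sG.1 y).2.
    - by [].
    - exact: dder_diff.
  have H12 : (fun y => F y (om y Y w)) = (fun y => 'd (F ^~ w) y Y + G y Y (F y w)).
    by apply/funext => y; exact: frame_formE.
  rewrite H12 in H1; rewrite linD // (frame_formE z X) addrA.
  have -> := addrC (F z ('d (fun z => om z Y w) z X)).
  have E12 := dder_unique H1 H2.
  transitivity (('d (fun y => 'd (F ^~ w) y Y) z X
        + ('d (fun y => G y Y (F z w)) z X + G z Y ('d (F ^~ w) z X)))
        + G z X (F z (om z Y w))).
    exact: (congr1 (fun t => t + _) E12).
  rewrite (frame_formE z Y w).
  by rewrite (bilinDr (sG.1 z)) !addrA.
have S : D2 B A = D2 A B by exact: smooth_diff_symmetric A B oU Uz (sF w).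
rewrite -[RHS](PK z); congr (P z _).
clearbody D2.
rewrite [in RHS](_ : _ - _ + _ - _ =
  ('d (fun z => om z B w) z A + om z A (om z B w))
  - ('d (fun z => om z A w) z B + om z B (om z A w))); last first.
  by rewrite opprD addrACA addrA.
rewrite linB // (E A B) (E B A) curv.unlock dform.unlock S.
by apply/rowP => j; rewrite !mxE; ring.
Qed.

End MovingFrame.

(** * Koszul's formula for a Sasakian metric *)

(** The pointwise algebra. A vector tangent to the tangent bundle is a pair of a
    horizontal and a vertical part; [oh a al p q] and [ov a al p q] are the parts of
    the connection form in the direction [(a, al)] applied to [(p, q)], [Ry a b]
    stands for the vector [R(a, b) y], and [dg a] for the derivative of [g] along
    [a]. The hypothesis [metric] says that the connection form preserves the direct
    sum of two copies of [g]. The hypotheses on the torsion record the brackets of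
    the frame, which are vertical: two horizontal fields contribute [Ry], a
    horizontal and a vertical one contribute [Gam]. *)
Section KoszulAlgebra.
Context {R : realType} {V : lmodType R}.
Variables (g : V -> V -> R) (dg : V -> V -> V -> R) (Gam Gamg : V -> V -> V).
Variables (Ry : V -> V -> V) (oh ov : V -> V -> V -> V -> V).
Local Notation K a b := (Gam a b - Gamg a b).
Hypotheses (Lg : bilin g) (LGam : bilin Gam) (LGamg : bilin Gamg).
Hypotheses (g_sym : forall u v, g u v = g v u).
Hypothesis Ry0r : forall a, Ry a 0 = 0.
Hypotheses (Gam_sym : forall a b, Gam a b = Gam b a).
Hypotheses (Gamg_sym : forall a b, Gamg a b = Gamg b a).
Hypothesis dgE : forall a b c, dg a b c = g (Gamg a b) c + g (Gamg a c) b.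
Hypothesis codazzi : forall a b c,
  dg a b c - g (Gam a b) c - g (Gam a c) b = dg b a c - g (Gam b a) c - g (Gam b c) a.
Hypothesis metric : forall a al p q p' q',
  dg a p p' + dg a q q' = g (oh a al p q) p' + g (ov a al p q) q'
                          + g (oh a al p' q') p + g (ov a al p' q') q.
Hypothesis torsion_h : forall a al b be, oh a al b be = oh b be a al.
Hypothesis torsion_v : forall a al b be,
  ov a al b be = ov b be a al - Ry a b + Gam a be - Gam b al.

(** [K] is symmetric because both connections are torsion-free; Codazzi's equation
    makes the trilinear form that it defines totally symmetric. *)
Lemma difference_symmetric a b c : g (K a b) c = g (K a c) b.
Proof.
have := codazzi a b c; have := codazzi c a b; have := codazzi b c a.
rewrite !dgE !(bilinBl Lg) (Gamg_sym c a) (Gamg_sym b a) (Gamg_sym c b).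
rewrite (Gam_sym c a) (Gam_sym b a) (Gam_sym c b); lra.
Qed.

(** Koszul's formula: the metric equation for the three cyclic permutations of
    [(a, al)], [(b, be)] and the vertical vector [(0, c)]. *)
Lemma koszul_v a al b be c :
  g (ov a al b be) c = g (Gamg a be) c - g (K al b) c - g (Ry a b) c / 2.
Proof.
have := metric a al b be 0 c; have := metric b be 0 c a al.
have := metric 0 c a al b be.
rewrite !dgE !(bilin0r Lg) !(bilin0l LGamg) !(bilin0r LGamg) !(bilin0l Lg).
rewrite (torsion_h a al 0 c) (torsion_h b be 0 c).
rewrite (torsion_v a al 0 c) (torsion_v b be 0 c) (torsion_v b be a al).
have := congr1 (g^~ c) (torsion_v a al b be).
rewrite (torsion_v b be a al) !Ry0r.
rewrite !(bilinDl Lg) !(bilinNl Lg) !(bilin0l LGam) !(bilin0l Lg).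
have := difference_symmetric a be c; have := difference_symmetric b al c.
have := difference_symmetric c be a.
rewrite !(bilinBl Lg) (Gam_sym al b) (Gamg_sym al b); lra.
Qed.

(** The same with the horizontal vector [(c, 0)]. *)
Lemma koszul_h a al b be c :
  g (oh a al b be) c = g (Gamg a b) c + g (K al be) c
                       + (g (Ry a c) be + g (Ry b c) al) / 2.
Proof.
have := metric a al b be c 0; have := metric b be c 0 a al.
have := metric c 0 a al b be.
rewrite !dgE !(bilin0r Lg) !(bilin0r LGamg) !(bilin0l Lg).
rewrite (torsion_h a al c 0) (torsion_h b be c 0) (torsion_h b be a al).
rewrite (torsion_v a al c 0) (torsion_v b be c 0).
rewrite !(bilinDl Lg) !(bilinNl Lg) !(bilin0r LGam) !(bilin0l Lg).
have := difference_symmetric c al be; have := difference_symmetric al be c.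
rewrite !(bilinBl Lg) (Gam_sym al c) (Gamg_sym al c) (Gamg_sym b a).
rewrite (Gamg_sym c a) (Gamg_sym c b) (g_sym (Gamg al be)); lra.
Qed.

End KoszulAlgebra.

(** * The Sasakian metric in a chart *)

HB.lock Definition conn_diff {R : realType} {m : nat}
    (G G' : 'rV[R]_m -> 'rV[R]_m -> 'rV[R]_m -> 'rV[R]_m) x a b : 'rV[R]_m :=
  G x a b - G' x a b.

Section SasakiChart.
Context {R : realType} {n : nat}.
Local Notation vec := 'rV[R]_n.
Local Notation tvec := 'rV[R]_(n + n).
Variables (U : set vec) (g : vec -> vec -> vec -> R).
Variables (Gam Gamg : vec -> vec -> vec -> vec).
Variables (gt : tvec -> tvec -> tvec -> R) (Gt : tvec -> tvec -> tvec -> tvec).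
Local Notation hor := (@lsubmx R 1 n n).
Local Notation ver := (@rsubmx R 1 n n).
Local Notation T := (hor @^-1` U).

Local Notation K := (conn_diff Gam Gamg).

(** The vertical part of [(a, al)] at [(x, y)] measures how far it is from the
    horizontal vector [(a, - Gam x a y)], the velocity of a parallel field. *)
Definition coframe z A : tvec := row_mx (hor A) (ver A + Gam (hor z) (hor A) (ver z)).
Definition frame z w : tvec := row_mx (hor w) (ver w - Gam (hor z) (hor w) (ver z)).
(** The components of the covariant derivative of the difference tensor. *)
Definition nabla_conn_diff x a b c : vec :=
  dform K x a b c + Gam x a (K x b c) - K x (Gam x a b) c - K x b (Gam x a c).

Hypotheses (oU : open U) (sg : smooth_bilin U g).
Hypotheses (sGam : smooth_bilin U Gam) (sGamg : smooth_bilin U Gamg).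
Hypotheses (sgt : smooth_bilin T gt) (sGt : smooth_bilin T Gt).
Hypotheses (g_sym : forall x u v, U x -> g x u v = g x v u).
Hypotheses (g_pos : forall x u, U x -> u != 0 -> 0 < g x u u).
Hypotheses (Gam_sym : forall x a b, U x -> Gam x a b = Gam x b a).
Hypotheses (Gamg_sym : forall x a b, U x -> Gamg x a b = Gamg x b a).
Hypotheses (Gamg_metric : forall x a b c, U x ->
  dform g x a b c = g x (Gamg x a b) c + g x b (Gamg x a c)).
Hypotheses (Gam_codazzi : forall x a b c, U x ->
  dform g x a b c - g x (Gam x a b) c - g x b (Gam x a c)
  = dform g x b a c - g x (Gam x b a) c - g x a (Gam x b c)).
Hypotheses (Gt_sym : forall z A B, T z -> Gt z A B = Gt z B A).
Hypotheses (Gt_metric : forall z A B C, T z ->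
  dform gt z A B C = gt z (Gt z A B) C + gt z B (Gt z A C)).
Hypotheses (gtE : forall z A B, T z -> gt z A B =
  g (hor z) (hor A) (hor B) + g (hor z) (ver (coframe z A)) (ver (coframe z B))).

Let LGam x : bilin (Gam x) := sGam.1 x.
Let LGamg x : bilin (Gamg x) := sGamg.1 x.
Let Lg x : bilin (g x) := sg.1 x.

Let oT : open T.
Proof. by apply: open_comp => // z _; exact: continuous_lsubmx. Qed.

Let dder_hor (z A : tvec) : dder (fun z : tvec => hor z) z A (hor A).
Proof. exact: dder_lin (@lsub_linear R n n) (dder_id z A). Qed.

Let dder_ver (z A : tvec) : dder (fun z : tvec => ver z) z A (ver A).
Proof. exact: dder_lin (@rsub_linear R n n) (dder_id z A). Qed.

Lemma conn_diff_smooth : smooth_bilin U K.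
Proof.
rewrite conn_diff.unlock; split=> [x|u v k]; last first.
  by apply: CkB => //; [exact: sGam.2 | exact: sGamg.2].
split=> [v|u] c a b.
  rewrite !(bilinDl (LGam x)) !(bilinDl (LGamg x)) !(bilinZl (LGam x)).
  by rewrite !(bilinZl (LGamg x)) scalerBr opprD addrACA.
rewrite !(bilinDr (LGam x)) !(bilinDr (LGamg x)) !(bilinZr (LGam x)).
by rewrite !(bilinZr (LGamg x)) scalerBr opprD addrACA.
Qed.
Let sK := conn_diff_smooth.
Let LK x : bilin (K x) := sK.1 x.

Lemma frameK z A : frame z (coframe z A) = A.
Proof. by rewrite /frame /coframe row_mxKl row_mxKr addrK hsubmxK. Qed.

Lemma coframeK z w : coframe z (frame z w) = w.
Proof. by rewrite /frame /coframe row_mxKl row_mxKr subrK hsubmxK. Qed.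

Lemma frame_linear z : linear (frame z).
Proof.
move=> c u v; rewrite /frame !linearP /= (bilinDl (LGam _)) (bilinZl (LGam _)).
by rewrite scale_row_mx add_row_mx scalerBr opprD addrACA.
Qed.

Lemma coframe_linear z : linear (coframe z).
Proof.
move=> c u v; rewrite /coframe !linearP /= (bilinDl (LGam _)) (bilinZl (LGam _)).
by rewrite scale_row_mx add_row_mx scalerDr addrACA.
Qed.

Lemma smooth_hor : smooth_on T (fun z : tvec => hor z).
Proof.
by move=> k; apply: Ck_lin => //; [exact: lsub_linear | exact: Ck_id].
Qed.

Lemma smooth_ver : smooth_on T (fun z : tvec => ver z).
Proof.
by move=> k; apply: Ck_lin => //; [exact: rsub_linear | exact: Ck_id].
Qed.

Lemma smooth_base (W : normedModType R) (f : vec -> W) : smooth_on U f ->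
  smooth_on T (fun z => f (hor z)).
Proof.
by move=> Cf k; apply: (Ck_comp (U' := U)) => //; exact: smooth_hor.
Qed.

Lemma smooth_connector a : smooth_on T (fun z : tvec => Gam (hor z) a (ver z)).
Proof.
move=> k; apply: (Ck_linapp (B := fun z => Gam (hor z) a)) => //.
- by move=> z; exact: (LGam _).2.
- by move=> u; exact: (smooth_base (sGam.2 a u)).
- exact: smooth_ver.
Qed.

Lemma frame_smooth w : smooth_on T (frame ^~ w).
Proof.
move=> k; apply: Ck_row => //; first exact: Ck_cst.
by apply: CkB => //; [exact: Ck_cst | exact: smooth_connector].
Qed.

Lemma coframe_smooth A : smooth_on T (coframe ^~ A).
Proof.
move=> k; apply: Ck_row => //; first exact: Ck_cst.
apply: (CkD (f := fun=> ver A)) => //; [exact: Ck_cst | exact: smooth_connector].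
Qed.

Local Notation om := (frame_form Gt frame coframe).

Lemma dder_connector z A b : T z -> dder (fun z : tvec => Gam (hor z) b (ver z)) z A
  (dform Gam (hor z) (hor A) b (ver z) + Gam (hor z) b (ver A)).
Proof.
move=> Tz; apply: dder_eq.
  exact: (dder_smooth_bilin sGam Tz (dder_hor z A) (dder_cst b z A) (dder_ver z A)).
by rewrite (bilin0l (LGam _)) addr0.
Qed.

(** The derivative of the coframe contributes the curvature of [Gam] and the
    derivative of vertical fields along horizontal ones. *)
Lemma sasaki_form_torsion z a al b be : T z ->
  let x := hor z in let y := ver z in
  om z (frame z (row_mx a al)) (row_mx b be)
  = om z (frame z (row_mx b be)) (row_mx a al)
    + row_mx 0 (- curv Gam x a b y + Gam x a be - Gam x b al).
Proof.
move=> Tz x y; set A := frame z (row_mx a al); set B := frame z (row_mx b be).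
have EA : coframe z A = row_mx a al by rewrite coframeK.
have EB : coframe z B = row_mx b be by rewrite coframeK.
have dP X Y : dder (coframe ^~ Y) z X
    (row_mx 0 (0 + (dform Gam x (hor X) (hor Y) y + Gam x (hor Y) (ver X)))).
  apply: dder_row; first exact: dder_cst.
  by apply: dderD; [exact: dder_cst | exact: dder_connector].
have := frame_form_torsion frame_linear frame_smooth
  coframe_smooth frameK coframeK Tz (Gt_sym A B Tz) (dP A B) (dP B A).
rewrite EA EB !add0r.
rewrite /A /B !(row_mxKl, row_mxKr) -/x -/y.
rewrite !(bilinBr (LGam x)) curv.unlock => /(canRL (addKr _)) ->.
rewrite addrA opp_row_mx add_row_mx addrC; congr (_ + row_mx _ _).
  by rewrite oppr0 addr0.
by apply/rowP => j; rewrite !mxE; ring.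
Qed.

(** In the moving frame the Sasakian metric is [g] on both parts, which depends on
    the base point only; this compares its derivative along [A] computed on the
    base with the metric equation of the connection [Gt]. *)
Lemma sasaki_form_metric z A w w' : T z -> let x := hor z in
  dform g x (hor A) (hor w) (hor w') + dform g x (hor A) (ver w) (ver w')
  = g x (hor (om z A w)) (hor w') + g x (ver (om z A w)) (ver w')
    + g x (hor (om z A w')) (hor w) + g x (ver (om z A w')) (ver w).
Proof.
move=> Tz x.
have nT : \forall t \near z, T t by exact: open_nbhs_nbhs.
have gF t u v : T t -> gt t (frame t u) (frame t v)
    = g (hor t) (hor u) (hor v) + g (hor t) (ver u) (ver v).
  by move=> Tt; rewrite gtE // !coframeK /frame !row_mxKl.
have dF u := dder_diff A (smooth_differentiable (frame_smooth u) Tz).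
have H1 := dder_smooth_bilin sgt (phi := id) Tz (dder_id z A) (dF w) (dF w').
have dg u v : dder (fun t : tvec => g (hor t) u v) z A (dform g x (hor A) u v).
  rewrite dform.unlock; have dg := smooth_bilin_differentiable sg u v Tz.
  exact: (dder_comp (h := fun y => g y u v)) (dder_hor z A) dg.
have H2 := dderD (dg (hor w) (hor w')) (dg (ver w) (ver w')).
have nE : \forall t \near z, gt t (frame t w) (frame t w')
    = g (hor t) (hor w) (hor w') + g (hor t) (ver w) (ver w').
  by apply: filterS nT => t; exact: gF.
have {}H1 := dder_near nE H1.
rewrite (dder_unique H2 H1) /= Gt_metric //.
have dE u : frame z (om z A u) - Gt z A (frame z u) = 'd (frame^~ u) z A.
  by rewrite frame_formE ?addrK //; exact: frameK.
have El u v := congr1 (fun d => gt z d v) (esym (dE u)).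
have Er u v := congr1 (gt z v) (esym (dE u)).
rewrite El Er (bilinBl (sgt.1 z)) (bilinBr (sgt.1 z)) !gF // -/x.
rewrite (g_sym (hor w)) // (g_sym (ver w)) //; ring.
Qed.

Lemma g_nondegenerate x u v : U x -> (forall c, g x u c = g x v c) -> u = v.
Proof.
move=> Ux E; apply/eqP; rewrite -subr_eq0; apply/negPn/negP => nz.
by have := g_pos Ux nz; rewrite (bilinBl (Lg x)) E subrr ltxx.
Qed.

Lemma curv_antisym x a b c : curv Gam x a b c = - curv Gam x b a c.
Proof. by rewrite curv.unlock; apply/rowP => j; rewrite !mxE; ring. Qed.

Lemma curv0l x b c : U x -> curv Gam x 0 b c = 0.
Proof.
move=> Ux; rewrite curv.unlock (lin0 (dform_linear Gam x b c)).
rewrite (bilin0l (dform_bilin sGam b Ux)) !(bilin0l (LGam x)) (bilin0r (LGam x)).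
by rewrite !subr0 addr0.
Qed.

Lemma curv0r x a c : U x -> curv Gam x a 0 c = 0.
Proof. by move=> Ux; rewrite curv_antisym curv0l ?oppr0. Qed.

Lemma curv_linear a b y : U y -> linear (curv Gam y a b).
Proof.
move=> Uy k u v; rewrite curv.unlock.
rewrite (dform_bilin sGam a Uy).2 (dform_bilin sGam b Uy).2.
rewrite !(bilinDr (LGam y)) !(bilinZr (LGam y)).
have E (p q r s p' q' r' s' : vec) : k *: p + p' - (k *: q + q') + (k *: r + r')
    - (k *: s + s') = k *: (p - q + r - s) + (p' - q' + r' - s').
  by apply/rowP => j; rewrite !mxE; ring.
exact: E.
Qed.

Lemma curv_smooth a b c : smooth_on U (fun y => curv Gam y a b c).
Proof.
rewrite curv.unlock; have S u v w : smooth_on U (fun y => Gam y u (Gam y v w)).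
  move=> k; apply: (Ck_linapp (B := fun y => Gam y u)) => //.
  - by move=> y; exact: (LGam y).2.
  - by move=> t; exact: sGam.2.
  - exact: sGam.2.
move=> k; apply: CkB => //; last exact: S.
apply: (CkD (f := fun y => dform Gam y a b c - dform Gam y b a c)) => //;
  last exact: S.
by rewrite dform.unlock; apply: CkB => //; exact: smooth_diff (sGam.2 _ _) _.
Qed.

Section Koszul.
Variables (z : tvec) (Tz : T z).
Let x := hor z.
Let y := ver z.
Let Om a al b be := om z (frame z (row_mx a al)) (row_mx b be).

Let koszul_hyps : [/\ forall a b c, dform g x a b c =
    g x (Gamg x a b) c + g x (Gamg x a c) b,
  forall a b c, dform g x a b c - g x (Gam x a b) c - g x (Gam x a c) b
   = dform g x b a c - g x (Gam x b a) c - g x (Gam x b c) a,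
  forall a al p q p' q', dform g x a p p' + dform g x a q q' =
    g x (hor (Om a al p q)) p' + g x (ver (Om a al p q)) q'
    + g x (hor (Om a al p' q')) p + g x (ver (Om a al p' q')) q,
  forall a al b be, hor (Om a al b be) = hor (Om b be a al) &
  forall a al b be, ver (Om a al b be) = ver (Om b be a al)
   - curv Gam x a b y + Gam x a be - Gam x b al].
Proof.
split=> [a b c|a b c|a al p q p' q'|a al b be|a al b be].
- by rewrite Gamg_metric // (g_sym b).
- by have := Gam_codazzi a b c Tz; rewrite (g_sym b) // (g_sym a).
- have := sasaki_form_metric (frame z (row_mx a al)) (row_mx p q) (row_mx p' q') Tz.
  by rewrite /= !row_mxKl !row_mxKr.
- by rewrite /Om sasaki_form_torsion // linearD /= row_mxKl addr0.
- by rewrite /Om sasaki_form_torsion // linearD /= row_mxKr !addrA.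
Qed.

Let omE B w : om z B w = Om (hor B) (ver (coframe z B)) (hor w) (ver w).
Proof.
rewrite /Om hsubmxK; congr (om z _ _).
have -> : row_mx (hor B) (ver (coframe z B)) = coframe z B.
  by rewrite /coframe row_mxKr.
by rewrite frameK.
Qed.

Lemma frame_form_v B w : ver (om z B w) = Gamg x (hor B) (ver w)
  - K x (ver (coframe z B)) (hor w) - 2^-1 *: curv Gam x (hor B) (hor w) y.
Proof.
have [H1 H2 H3 H4 H5] := koszul_hyps.
apply: (g_nondegenerate Tz) => c.
have := koszul_v (Ry := fun a b => curv Gam x a b y) (Lg x) (LGam x) (LGamg x)
  (fun a => curv0r a y Tz) (fun a b => Gam_sym a b Tz)
  (fun a b => Gamg_sym a b Tz) H1 H2 H3 H4 H5.
rewrite omE => ->; rewrite (bilinBl (Lg x) _ (2^-1 *: _)).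
rewrite (bilinBl (Lg x) _ (K x _ _)) (bilinZl (Lg x)) conn_diff.unlock; congr (_ - _).
by rewrite mulrC.
Qed.

Lemma frame_form_h B w : (forall a b, curv Gam x a b y = 0) ->
  hor (om z B w) = Gamg x (hor B) (hor w) + K x (ver (coframe z B)) (ver w).
Proof.
have [H1 H2 H3 H4 H5] := koszul_hyps.
move=> R0; apply: (g_nondegenerate Tz) => c.
have := koszul_h (Ry := fun a b => curv Gam x a b y) (Lg x) (LGam x) (LGamg x)
  (fun u v => g_sym u v Tz) (fun a b => Gam_sym a b Tz)
  (fun a b => Gamg_sym a b Tz) H1 H2 H3 H4 H5.
rewrite omE => ->; rewrite !R0 !(bilin0l (Lg x)) addr0 mul0r addr0.
by rewrite conn_diff.unlock; exact/esym/(bilinDl (Lg x)).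
Qed.

End Koszul.

Lemma dder_vertical z A B : T z -> dder (fun z => ver (coframe z B)) z A
  (dform Gam (hor z) (hor A) (hor B) (ver z) + Gam (hor z) (hor B) (ver A)).
Proof.
move=> Tz; have -> : (fun z => ver (coframe z B))
    = fun z => ver B + Gam (hor z) (hor B) (ver z).
  by apply/funext => t; rewrite /coframe row_mxKr.
by apply: dder_eq (dderD (dder_cst _ _ _) (dder_connector A _ Tz)) _; rewrite add0r.
Qed.

Lemma dder_base B a b z A : smooth_bilin U B -> T z ->
  dder (fun z : tvec => B (hor z) a b : vec) z A (dform B (hor z) (hor A) a b).
Proof.
move=> sB Tz; rewrite dform.unlock.
have dB := smooth_bilin_differentiable sB a b Tz.
exact: (dder_comp (h := fun y => B y a b)) (dder_hor z A) dB.
Qed.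

Lemma dder_conn_diff z A B p : T z -> let x := hor z in
  dder (fun z => K (hor z) (ver (coframe z B)) p) z A
    (dform K x (hor A) (ver (coframe z B)) p
     + K x (dform Gam x (hor A) (hor B) (ver z) + Gam x (hor B) (ver A)) p).
Proof.
move=> Tz x; apply: dder_eq.
  exact: (dder_smooth_bilin sK Tz (dder_hor z A) (dder_vertical A B Tz) (dder_cst p z A)).
by rewrite (bilin0r (LK _)) addr0.
Qed.

Lemma frame_form_dder z A B w : T z -> exists d, dder (fun z => om z B w) z A d.
Proof.
move=> Tz; exists ('d (fun z => om z B w) z A); apply: dder_diff.
apply: smooth_differentiable Tz.
exact: (frame_form_smooth oT sGt coframe_linear frame_smooth coframe_smooth).
Qed.

(** The structure equation for one part of the curvature at a time, [L] being the
    horizontal or the vertical projection. *)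
Lemma sasaki_curvature_component (L : tvec -> vec) z A B w dA dB : linear L -> T z ->
  dder (fun z => L (om z B w)) z A dA -> dder (fun z => L (om z A w)) z B dB ->
  L (coframe z (curv Gt z A B (frame z w))) =
  dA - dB + L (om z A (om z B w)) - L (om z B (om z A w)).
Proof.
move=> LL Tz HA HB; have [d Hd] := frame_form_dder A B w Tz.
have [e He] := frame_form_dder B A w Tz.
rewrite (frame_curvature oT sGt frame_linear coframe_linear frame_smooth
  coframe_smooth frameK coframeK Tz Hd He).
rewrite !(linB LL, linD LL); congr (_ - _ + _ - _).
  exact: dder_unique (dder_lin LL Hd) HA.
exact: dder_unique (dder_lin LL He) HB.
Qed.

Section ZeroSection.
Variables (x : vec) (Ux : U x).
Let z0 : tvec := row_mx x 0.
Let hor0 : hor z0 = x. Proof. exact: row_mxKl. Qed.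
Let ver0 : ver z0 = 0. Proof. exact: row_mxKr. Qed.
Let Tz0 : T z0. Proof. by rewrite /= hor0. Qed.

(** On the zero section, only the derivative along the fibre survives: the function
    is linear in the fibre coordinate. *)
Lemma dder_curv0 A b c : dder (fun z => curv Gam (hor z) b c (ver z)) z0 A
  (curv Gam x b c (ver A)).
Proof.
have nT : \forall t \near z0, T t by exact: open_nbhs_nbhs.
apply: dder_eq.
  apply: (dder_linapp_near (B := fun z => curv Gam (hor z) b c)) (dder_ver z0 A).
    by apply: filterS nT => t; exact: curv_linear.
  move=> u; exact: smooth_differentiable (smooth_base (curv_smooth b c u)) Tz0.
cbv beta; rewrite hor0 ver0.
suff E : dder (fun z => curv Gam (hor z) b c 0) z0 A 0 by rewrite (dderE E) add0r.
apply: dder_near (dder_cst 0 z0 A).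
by apply: filterS nT => t Tt; rewrite (lin0 (curv_linear b c Tt)).
Qed.

Lemma dder_frame_form_v0 A B w : dder (fun z => ver (om z B w)) z0 A
  (dform Gamg x (hor A) (hor B) (ver w)
   - (dform K x (hor A) (ver B) (hor w) + K x (Gam x (hor B) (ver A)) (hor w))
   - 2^-1 *: curv Gam x (hor B) (hor w) (ver A)).
Proof.
have nT : \forall t \near z0, T t by exact: open_nbhs_nbhs.
apply: (@dder_near _ _ _ (fun z => Gamg (hor z) (hor B) (ver w)
  - K (hor z) (ver (coframe z B)) (hor w)
  - 2^-1 *: curv Gam (hor z) (hor B) (hor w) (ver z))).
  by apply: filterS nT => t Tt; rewrite frame_form_v.
apply: dderB; first apply: dderB.
- by apply: dder_eq (dder_base _ _ A sGamg Tz0) _; rewrite hor0.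
- apply: dder_eq (dder_conn_diff A B (hor w) Tz0) _.
  rewrite /coframe row_mxKr hor0 ver0 (bilin0r (LGam x)) addr0.
  by rewrite (bilin0r (dform_bilin sGam _ Ux)) add0r.
- apply: dder_eq (dderZ (dder_cst (2^-1 : R) z0 A) (dder_curv0 A (hor B) (hor w))) _.
  by rewrite scale0r add0r.
Qed.

Lemma frame_form_v0 B w :
  ver (om z0 B w) = Gamg x (hor B) (ver w) - K x (ver B) (hor w).
Proof.
rewrite frame_form_v // /coframe row_mxKr hor0 ver0 (lin0 (curv_linear _ _ Ux)).
by rewrite (bilin0r (LGam x)) addr0 scaler0 subr0.
Qed.

(** The terms of the horizontal part that are not known explicitly are linear in
    the fibre coordinate, hence absent on the zero section. *)
Lemma frame_form_h0 B w :
  hor (om z0 B w) = Gamg x (hor B) (hor w) + K x (ver B) (ver w).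
Proof.
rewrite frame_form_h // => [|a b]; rewrite ?hor0 ?ver0 ?(lin0 (curv_linear _ _ Ux)) //.
by rewrite /coframe row_mxKr hor0 ver0 (bilin0r (LGam x)) addr0.
Qed.

Hypothesis flat_t : forall A B C, curv Gt z0 A B C = 0.

Let dv (a al b be p q : vec) := dform Gamg x a b q
  - (dform K x a be p + K x (Gam x b al) p) - 2^-1 *: curv Gam x b p al.
Let vv (a al b be p q : vec) := Gamg x a (Gamg x b q - K x be p)
  - K x al (Gamg x b p + K x be q).

(** The vertical part of the structure equation: [dv] is the derivative of the
    connection form and [vv] its square. *)
Lemma zero_section_curvature a al b be p q :
  dv a al b be p q - dv b be a al p q + vv a al b be p q - vv b be a al p q = 0.
Proof.
suff H A B w : dv (hor A) (ver A) (hor B) (ver B) (hor w) (ver w)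
    - dv (hor B) (ver B) (hor A) (ver A) (hor w) (ver w)
    + vv (hor A) (ver A) (hor B) (ver B) (hor w) (ver w)
    - vv (hor B) (ver B) (hor A) (ver A) (hor w) (ver w) = 0.
  have := H (row_mx a al) (row_mx b be) (row_mx p q).
  by rewrite !row_mxKl !row_mxKr.
have := sasaki_curvature_component (@rsub_linear R n n) Tz0
  (dder_frame_form_v0 A B w) (dder_frame_form_v0 B A w).
rewrite flat_t (lin0 (coframe_linear z0)) (lin0 (@rsub_linear R n n)).
rewrite !frame_form_v0 !frame_form_h0.
by move=> <-.
Qed.

Let zeros := (fun b c => lin0 (dform_linear Gamg x b c),
  fun b c => lin0 (dform_linear K x b c),
  bilin0l (LK x), bilin0r (LK x), bilin0l (LGam x), bilin0r (LGam x),
  bilin0l (LGamg x), bilin0r (LGamg x), fun a => bilin0l (dform_bilin sK a Ux),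
  fun a => bilin0r (dform_bilin sK a Ux), fun a => bilin0l (dform_bilin sGamg a Ux),
  fun a => bilin0r (dform_bilin sGamg a Ux), fun b c => curv0l b c Ux,
  fun a c => curv0r a c Ux, fun a b => lin0 (curv_linear a b Ux),
  scaler0 vec, @subr0 vec, @sub0r vec, @addr0 vec, @add0r vec, @oppr0 vec).

(** Two vertical directions applied to a vertical vector. *)
Lemma flat_commute al be q : K x al (K x be q) = K x be (K x al q).
Proof.
have := zero_section_curvature 0 al 0 be 0 q; rewrite /dv /vv !zeros opprK.
by rewrite addrC => /eqP; rewrite subr_eq0 => /eqP.
Qed.

(** Two horizontal directions applied to a vertical vector. *)
Lemma flat_base a b q : curv Gamg x a b q = 0.
Proof.
have := zero_section_curvature a 0 b 0 0 q; rewrite /dv /vv !zeros.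
by rewrite curv.unlock.
Qed.

Let GamE a v : Gam x a v = Gamg x a v + K x a v.
Proof. by rewrite conn_diff.unlock addrCA subrr addr0. Qed.

(** A horizontal and a vertical direction applied to a horizontal vector. The
    equation comes out with [Gamg] instead of [Gam] in two terms of the covariant
    derivative of [K]; by [flat_commute] this makes no difference. *)
Lemma flat_mixed a b p : 2^-1 *: curv Gam x a p b = nabla_conn_diff x a b p.
Proof.
have := zero_section_curvature a 0 0 b p 0; rewrite /dv /vv !zeros.
rewrite /nabla_conn_diff (GamE a p) (GamE a (K x b p)) (bilinDr (LK x)).
rewrite (bilinNr (LGamg x)) (flat_commute a) => /rowP E; apply/rowP => j; have := E j.
by rewrite !mxE; lra.
Qed.

Lemma nabla_conn_diff_sym a b c : nabla_conn_diff x a b c = nabla_conn_diff x a c b.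
Proof.
have Ksym y u v : U y -> K y u v = K y v u.
  by move=> Uy; rewrite conn_diff.unlock Gam_sym // Gamg_sym.
have E : dform K x a b c = dform K x a c b.
  have nU : \forall y \near x, K y c b = K y b c.
    by apply: filterS (open_nbhs_nbhs (conj oU Ux)) => y Uy; exact: Ksym.
  have d := dder_diff a (smooth_bilin_differentiable sK c b Ux).
  by rewrite dform.unlock; exact: dderE (dder_near nU d).
rewrite /nabla_conn_diff (Ksym x b c Ux) (Ksym x b (Gam x a c) Ux).
by rewrite (Ksym x (Gam x a b) c Ux) E addrAC.
Qed.

(** It is symmetric in the last two arguments and, by [flat_mixed], antisymmetric in
    the first and the last one. Alternating the two symmetries returns to the same
    order of the arguments after three changes of sign. *)
Lemma flat_parallel a b c : nabla_conn_diff x a b c = 0.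
Proof.
have A u v w : nabla_conn_diff x u v w = - nabla_conn_diff x w v u.
  by rewrite -!flat_mixed curv_antisym scalerN.
have E : nabla_conn_diff x a b c = - nabla_conn_diff x a b c.
  rewrite {1}nabla_conn_diff_sym A nabla_conn_diff_sym A opprK.
  by rewrite nabla_conn_diff_sym A nabla_conn_diff_sym.
apply/rowP => j; move/rowP: E => /(_ j); rewrite !mxE; lra.
Qed.

Lemma flat_curv a b c : curv Gam x a b c = 0.
Proof.
have /eqP := flat_mixed a c b; rewrite flat_parallel scaler_eq0 invr_eq0.
by rewrite pnatr_eq0 /= => /eqP.
Qed.

End ZeroSection.

Section FlatBase.
Hypotheses (R0 : forall x a b c, U x -> curv Gam x a b c = 0).
Hypotheses (Rg0 : forall x a b c, U x -> curv Gamg x a b c = 0).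
Hypotheses (parK : forall x a b c, U x -> nabla_conn_diff x a b c = 0).

Section Point.
Variables (x : vec) (Ux : U x).

Let GamE a v : Gam x a v = Gamg x a v + K x a v.
Proof. by rewrite conn_diff.unlock addrCA subrr addr0. Qed.

Lemma dform_conn_diff a b c :
  dform K x a b c = dform Gam x a b c - dform Gamg x a b c.
Proof.
rewrite dform.unlock conn_diff.unlock; apply: dderE; apply: dderB; apply: dder_diff.
  exact: (smooth_bilin_differentiable sGam).
exact: (smooth_bilin_differentiable sGamg).
Qed.

(** The difference of the curvatures of [Gam] and [Gamg] is the antisymmetrized
    covariant derivative of [K] plus the commutator of [K], so all the other terms
    vanish. *)
Lemma parallel_commute a b c : K x a (K x b c) = K x b (K x a c).
Proof.
have := Rg0 a b c Ux; have := R0 a b c Ux; have := parK a b c Ux.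
have := parK b a c Ux.
rewrite curv.unlock /nabla_conn_diff !dform_conn_diff (Gam_sym b a Ux).
rewrite (GamE a (Gam x b c)) (GamE b (Gam x a c)) (GamE a (K x b c)) (GamE b (K x a c)).
rewrite (GamE b c) (GamE a c) !(bilinDr (LGamg x)) !(bilinDr (LK x)).
move=> /rowP E1 /rowP E2 /rowP E3 /rowP E4; apply/rowP => j.
by move: (E1 j) (E2 j) (E3 j) (E4 j); rewrite !mxE; lra.
Qed.

(* The connection form as the operator [Gamg b - i K be] on [p + i q]: [H b be p q] is
   its real part, and its imaginary part is [H b be q (- p)]. *)
Let H (b be p q : vec) := Gamg x b p + K x be q.
Let dH (y a al b be p q : vec) := dform Gamg x a b p
  + (dform K x a be q + K x (dform Gam x a b y + Gam x b (al - Gam x a y)) q).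

(** The real part of the structure equation. Multiplying the vector by [- i]
    replaces [(p, q)] by [(q, - p)], so the imaginary part is an instance. *)
Lemma parallel_curvature y a al b be p q :
  dH y a al b be p q - dH y b be a al p q
  + H a al (H b be p q) (H b be q (- p)) - H b be (H a al p q) (H a al q (- p)) = 0.
Proof.
have E0 := Rg0 a b p Ux; have E1 := congr1 (fun v => K x v q) (R0 a b y Ux).
have := parK a be q Ux; have := parK b al q Ux; move: E0 E1.
rewrite /dH /H curv.unlock /nabla_conn_diff (bilin0l (LK x)).
rewrite (GamE a (K x be q)) (GamE b (K x al q)) (GamE a q) (GamE b q).
rewrite !(bilinDr (LGamg x), bilinBr (LGam x), bilinNr (LGamg x)).
rewrite !(bilinDr (LK x), bilinNr (LK x), bilinDl (LK x), bilinNl (LK x)).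
rewrite (parallel_commute a be q) (parallel_commute b al q).
rewrite (parallel_commute al be p).
move=> /rowP E1 /rowP E2 /rowP E3 /rowP E4; apply/rowP => j.
by move: (E1 j) (E2 j) (E3 j) (E4 j); rewrite !mxE; lra.
Qed.

End Point.

Lemma parallel_flat z A B C : T z -> curv Gt z A B C = 0.
Proof.
move=> Tz; rewrite -(frameK z (curv _ _ _ _ _)) -(frameK z C).
have nT : \forall t \near z, T t by exact: open_nbhs_nbhs.
move: (coframe z C) => w {C}.
suff -> : coframe z (curv Gt z A B (frame z w)) = 0 by exact: lin0 (frame_linear z).
have Eh t E v : T t -> hor (om t E v)
    = Gamg (hor t) (hor E) (hor v) + K (hor t) (ver (coframe t E)) (ver v).
  by move=> Tt; apply: frame_form_h => // a b; exact: R0.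
have Ev t E v : T t -> ver (om t E v)
    = Gamg (hor t) (hor E) (ver v) + K (hor t) (ver (coframe t E)) (- hor v).
  by move=> Tt; rewrite frame_form_v // R0 // scaler0 subr0 (bilinNr (LK _)).
pose dh (E F : tvec) p q := dform Gamg (hor z) (hor E) (hor F) p
  + (dform K (hor z) (hor E) (ver (coframe z F)) q
     + K (hor z) (dform Gam (hor z) (hor E) (hor F) (ver z)
                  + Gam (hor z) (hor F) (ver E)) q).
have Hh E F p q : dder (fun t => Gamg (hor t) (hor F) p
    + K (hor t) (ver (coframe t F)) q) z E (dh E F p q).
  exact: dderD (dder_base _ _ _ sGamg Tz) (dder_conn_diff E F q Tz).
have dhor E F : dder (fun t => hor (om t F w)) z E (dh E F (hor w) (ver w)).
  apply: dder_near (Hh E F (hor w) (ver w)).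
  by apply: filterS nT => t Tt; rewrite Eh.
have dver E F : dder (fun t => ver (om t F w)) z E (dh E F (ver w) (- hor w)).
  apply: dder_near (Hh E F (ver w) (- hor w)).
  by apply: filterS nT => t Tt; rewrite Ev.
have vE (E : tvec) : ver E = ver (coframe z E) - Gam (hor z) (hor E) (ver z).
  by rewrite /coframe row_mxKr addrK.
rewrite -[LHS]hsubmxK -[RHS]row_mx0; congr row_mx.
  rewrite (sasaki_curvature_component (@lsub_linear R n n) Tz (dhor A B) (dhor B A)).
  rewrite !Eh // !Ev // /dh (vE A) (vE B).
  exact: parallel_curvature Tz (ver z) (hor A) (ver (coframe z A)) (hor B)
    (ver (coframe z B)) (hor w) (ver w).
rewrite (sasaki_curvature_component (@rsub_linear R n n) Tz (dver A B) (dver B A)).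
have nEh E v : - hor (om z E v) = Gamg (hor z) (hor E) (- hor v)
    + K (hor z) (ver (coframe z E)) (- ver v).
  by rewrite Eh // opprD (bilinNr (LGamg _)) (bilinNr (LK _)).
rewrite !Ev // !nEh /dh (vE A) (vE B).
exact: parallel_curvature Tz (ver z) (hor A) (ver (coframe z A)) (hor B)
  (ver (coframe z B)) (ver w) (- hor w).
Qed.

End FlatBase.

Theorem sasaki_chart_flat :
  (forall z A B C, T z -> curv Gt z A B C = 0) <->
  (forall x a b c, U x ->
     [/\ curv Gam x a b c = 0, curv Gamg x a b c = 0
       & nabla_conn_diff x a b c = 0]).
Proof.
split=> [flat_t x a b c Ux|H z A B C]; last first.
  by apply: parallel_flat => x a b c /(H x a b c)[].
have flat0 A B C : curv Gt (row_mx x 0) A B C = 0.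
  by apply: flat_t; rewrite /= row_mxKl.
by split; [exact: flat_curv | exact: flat_base | exact: flat_parallel].
Qed.

End SasakiChart.

(** * Charts, smooth functions and vector fields *)

Section AtlasCalculus.
Context {R : realType} {m : nat} {M : atlas R m}.
Implicit Types (p q : M) (i j : chart M) (A B : set M).

Definition chart_image i A : set 'rV[R]_m := coord i @` (dom i `&` A).

Lemma tangentD p (u v : tangent p) i : (u + v) i = u i + v i.
Proof. by []. Qed.
Lemma tangentZ p a (u : tangent p) i : (a *: u) i = a *: u i.
Proof. by []. Qed.
Lemma tangent_sum p I (r : seq I) (F : I -> tangent p) i :
  (\sum_(k <- r) F k) i = \sum_(k <- r) F k i.
Proof. by elim/big_rec2: _ => // k y x _ <-. Qed.

Lemma tangent_inj i p (u v : tangent p) : dom i p -> u i = v i -> u = v.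
Proof. by move=> di E; rewrite -(tangentK u di) E tangentK. Qed.

Lemma chart_image_in i A p : dom i p -> A p -> chart_image i A (coord i p).
Proof. by move=> di Ap; exists p. Qed.

Lemma chart_image_param i A x : chart_image i A x ->
  [/\ dom i (param i x), A (param i x) & coord i (param i x) = x].
Proof. by move=> [p [di Ap] <-]; rewrite coordK. Qed.

Lemma mopen_dom i : mopen (dom i).
Proof. by move=> j; exact: open_overlap. Qed.
Arguments mopen_dom : clear implicits.

Lemma mopenI A B : mopen A -> mopen B -> mopen (A `&` B).
Proof.
move=> oA oB i; rewrite (_ : _ @` _ = chart_image i A `&` chart_image i B).
  by apply: openI; [exact: oA | exact: oB].
apply/seteqP; split=> [_ [p [di [Ap Bp]] <-]|x].
  by split; exact: chart_image_in.
move=> [/chart_image_param[di Ap E] /chart_image_param[_ Bp _]].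
by exists (param i x).
Qed.

Lemma near_chart_image i A p : mopen A -> dom i p -> A p ->
  \forall x \near coord i p, chart_image i A x.
Proof.
move=> oA di Ap; apply: open_nbhs_nbhs.
by split; [exact: oA | exact: chart_image_in].
Qed.

Lemma smooth_trans i j A : A `<=` dom i ->
  smooth_on (chart_image j A) (trans j i).
Proof.
move=> Ai k; apply: Ck_sub (smooth_overlap j i k).
by move=> _ [p [dj Ap] <-]; exists p => //; split=> //; exact: Ai.
Qed.

Lemma trans_chart_image i j A x : A `<=` dom i -> chart_image j A x ->
  chart_image i A (trans j i x).
Proof.
move=> Ai /chart_image_param[dj Ap E]; rewrite /trans /=.
by apply: chart_image_in => //; exact: Ai.
Qed.

(** On an open set inside one chart, smoothness in that chart is enough: any other
    chart differs from it by a smooth transition map. *)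
Lemma smooth_on_chart (W : normedModType R) i A (f : M -> W) :
  mopen A -> A `<=` dom i ->
  smooth_on (chart_image i A) (f \o param i) ->
  forall j, smooth_on (chart_image j A) (f \o param j).
Proof.
move=> oA Ai sf j k.
have C := Ck_comp (oA j) (fun x => @trans_chart_image i j A x Ai)
  (smooth_trans j Ai k) (sf k).
apply: Ck_ext C; first exact: oA.
move=> x /chart_image_param[dj Ap E]; rewrite /trans /= coordK //; exact: Ai.
Qed.

Lemma coord_vfield_smooth i v : smooth_vfield (dom i) (coord_vfield i v).
Proof.
move=> j k.
have ij x : chart_image j (dom i) x -> chart_image i (dom j) (trans j i x).
  by move=> /chart_image_param[dj di _]; rewrite /trans /=; exact: chart_image_in.
have C := Ck_comp (mopen_dom i j) ij (smooth_trans j (@subset_refl _ _) k)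
  (smooth_diff v (smooth_overlap i j) k).
apply: Ck_ext C; first exact: mopen_dom.
by move=> x /chart_image_param[dj di E]; rewrite /coord_vfield chart_tangentE.
Qed.

Lemma smooth_fun_component i A (Y : vfield M) b : mopen A -> smooth_vfield A Y ->
  smooth_fun (A `&` dom i) (fun p => Y p i 0 b).
Proof.
move=> oA sY.
have oAi : mopen (A `&` dom i) by exact: mopenI (mopen_dom i).
apply: (smooth_on_chart (i := i)) => // k.
apply: Ck_coord; first exact: oAi.
by apply: Ck_sub (sY i k) => _ [p [di [Ap _]] <-]; exists p.
Qed.

Lemma smooth_vfield_sub A B (Y : vfield M) : A `<=` B ->
  smooth_vfield B Y -> smooth_vfield A Y.
Proof.
move=> AB sY i k; apply: Ck_sub (sY i k) => _ [p [di Ap] <-].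
by exists p => //; split=> //; exact: AB.
Qed.

Lemma smooth_fun_sub A B (f : M -> R) : A `<=` B ->
  smooth_fun B f -> smooth_fun A f.
Proof.
move=> AB sf i k; apply: Ck_sub (sf i k) => _ [p [di Ap] <-].
by exists p => //; split=> //; exact: AB.
Qed.

Lemma smooth_vfieldD A (X Y : vfield M) : mopen A -> smooth_vfield A X ->
  smooth_vfield A Y -> smooth_vfield A (fun p => X p + Y p).
Proof. by move=> oA sX sY i k; apply: CkD (sX i k) (sY i k); exact: oA. Qed.

Lemma smooth_vfieldB A (X Y : vfield M) : mopen A -> smooth_vfield A X ->
  smooth_vfield A Y -> smooth_vfield A (fun p => X p - Y p).
Proof. by move=> oA sX sY i k; apply: CkB (sX i k) (sY i k); exact: oA. Qed.

Lemma smooth_vfieldZ A f (X : vfield M) : mopen A -> smooth_fun A f ->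
  smooth_vfield A X -> smooth_vfield A (fun p => f p *: X p).
Proof.
move=> oA sf sX i k; apply: (Ck_scale (f := f \o param i)) (sX i k).
  exact: oA.
exact: sf.
Qed.

Lemma smooth_vfield0 A : smooth_vfield A (fun p => 0 : tangent p).
Proof. by move=> i k; exact: Ck_cst. Qed.

Lemma smooth_vfield_sum A I (r : seq I) (F : I -> vfield M) : mopen A ->
  (forall b, smooth_vfield A (F b)) ->
  smooth_vfield A (fun p => \sum_(b <- r) F b p).
Proof.
move=> oA sF; elim: r => [|b r IH].
  rewrite (_ : (fun p => _) = fun p => 0); first exact: smooth_vfield0.
  by apply/functional_extensionality_dep => p; rewrite big_nil.
rewrite (_ : (fun p => _) = fun p => F b p + \sum_(b <- r) F b p).
  exact: smooth_vfieldD.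
by apply/functional_extensionality_dep => p; rewrite big_cons.
Qed.

Lemma smooth_fun_cst A (c : R) : smooth_fun A (fun=> c).
Proof. by move=> i k; exact: Ck_cst. Qed.

Lemma smooth_vfield_ext A (X Y : vfield M) : mopen A ->
  (forall p, A p -> X p = Y p) -> smooth_vfield A X -> smooth_vfield A Y.
Proof.
move=> oA XY sX i k; apply: Ck_ext (sX i k); first exact: oA.
by move=> x /chart_image_param[_ Ap _]; rewrite XY.
Qed.

Lemma smooth_fun_differentiable A (f : M -> R) i p :
  smooth_fun A f -> A p -> dom i p -> differentiable (f \o param i) (coord i p).
Proof.
move=> sf Ap di; apply: smooth_differentiable (sf i) _.
exact: chart_image_in.
Qed.

(** The chain rule makes the directional derivative independent of the chart. *)
Lemma vderiveE A f i p (u : tangent p) :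
  mopen A -> smooth_fun A f -> A p -> dom i p ->
  vderive u f = 'd (f \o param i) (coord i p) (u i).
Proof.
move=> oA sf Ap di; rewrite /vderive; set j := chart_at p.
have dj : dom j p by exact: chart_atP.
have /asboolP[_ /(_ j i dj di) ->] := comp_coherent u.
have dt := trans_differentiable dj di.
have tij := trans_in dj di.
have df : differentiable (f \o param i) (trans j i (coord j p)).
  by rewrite tij; exact: smooth_fun_differentiable sf Ap di.
have H := dder_comp (dder_diff (u j) dt) df.
rewrite tij in H; apply: dderE; apply: dder_near H.
apply: filterS (near_overlap dj di) => x [djx [dix E]].
by rewrite /trans /= coordK.
Qed.

Lemma vderive_locally_cst A f p (u : tangent p) c : mopen A -> A p ->
  (forall q, A q -> f q = c) -> vderive u f = 0.
Proof.
move=> oA Ap fc; rewrite /vderive; apply: dderE; apply: dder_near (dder_cst c _ _).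
have := near_chart_image oA (chart_atP p) Ap.
by apply: filterS => x /chart_image_param[_ Aq _] /=; rewrite fc.
Qed.

End AtlasCalculus.
Arguments mopen_dom {R m M} i _ _ _.
Arguments coord_vfield_smooth {R m M} i v _ _.

(** * Connections and metrics in a chart *)

Section ArrayForm.
Context {R : realType} {m : nat} {W : lmodType R}.

(** The bilinear map with given coefficients. Defining the coefficient fields of
    connections and metrics in this way makes them bilinear also at the points
    outside the image of the chart. *)
Definition array_form (c : 'I_m -> 'I_m -> W) (u v : 'rV[R]_m) : W :=
  \sum_a u 0 a *: \sum_b v 0 b *: c a b.

Lemma array_form_bilin c : bilin (array_form c).
Proof.
split=> [v|u] k x y; rewrite /array_form scaler_sumr -big_split /=.
  by apply: eq_bigr => a _; rewrite !mxE scalerDl scalerA.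
apply: eq_bigr => a _; rewrite scalerA mulrC -scalerA -scalerDr; congr (_ *: _).
rewrite scaler_sumr -big_split /=.
by apply: eq_bigr => b _; rewrite !mxE scalerDl scalerA.
Qed.

Lemma array_formE (B : 'rV[R]_m -> 'rV[R]_m -> W) u v : bilin B ->
  array_form (fun a b => B (basis a) (basis b)) u v = B u v.
Proof.
move=> LB; rewrite (lin_basis (f := B ^~ v) u (LB.1 v)).
by apply: eq_bigr => a _; rewrite (lin_basis (f := B (basis a)) v (LB.2 _)).
Qed.

End ArrayForm.

Section ConnectionInChart.
Context {R : realType} {m : nat} {M : atlas R m}.
Implicit Types (p q : M) (i j : chart M) (A B : set M).
Variable D : connection M.

(** Two fields that agree on an open set have the same product with its
    indicator function, to which the Leibniz rule applies. *)
Lemma cov_local A (Y Z : vfield M) p u : mopen A -> A p -> smooth_vfield A Y ->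
  (forall q, A q -> Y q = Z q) -> D p u Y = D p u Z.
Proof.
move=> oA Ap sY YZ; pose f q : R := if `[< A q >] then 1 else 0.
have f1 q : A q -> f q = 1 by move=> Aq; rewrite /f asboolT.
have sf : smooth_fun A f.
  move=> i k; apply: Ck_ext (Ck_cst k _ (1 : R)); first exact: oA.
  by move=> x /chart_image_param[_ Aq _] /=; rewrite f1.
have E X : smooth_vfield A X -> D p u X = D p u (fun q => f q *: X q).
  move=> sX; rewrite (cov_leibniz D u oA Ap sf sX) (vderive_locally_cst _ oA Ap f1).
  by rewrite scale0r add0r f1 // scale1r.
rewrite E // (E Z); last exact: smooth_vfield_ext oA YZ sY.
congr (D p u _); apply/functional_extensionality_dep => q; rewrite /f.
by case: asboolP => [/YZ ->|_] //; rewrite !scale0r.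
Qed.

Lemma cov0 p u : D p u (fun q => 0) = 0.
Proof.
have oT : mopen (@setT M).
  move=> i; rewrite (_ : _ @` _ = chart_image i (dom i)); first exact: mopen_dom.
  by congr (_ @` _); rewrite setIT setIid.
have := cov_leibniz D u (p := p) oT Logic.I (smooth_fun_cst setT 0)
  (smooth_vfield0 setT).
rewrite (vderive_locally_cst u oT Logic.I (c := 0)) // !scale0r addr0.
move=> <-; congr (D p u _).
by apply/functional_extensionality_dep => q; rewrite scale0r.
Qed.

Lemma cov_sum A I (r : seq I) (F : I -> vfield M) p u : mopen A -> A p ->
  (forall b, smooth_vfield A (F b)) ->
  D p u (fun q => \sum_(b <- r) F b q) = \sum_(b <- r) D p u (F b).
Proof.
move=> oA Ap sF; elim: r => [|b r IH].
  rewrite big_nil -[RHS](cov0 u); congr (D p u _).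
  by apply/functional_extensionality_dep => q; rewrite big_nil.
rewrite big_cons -IH -(cov_add D u oA Ap (sF b) (smooth_vfield_sum r oA sF)).
congr (D p u _).
by apply/functional_extensionality_dep => q; rewrite big_cons.
Qed.

Lemma chart_tangent_linear i p : dom i p -> linear (@chart_tangent R m M i p).
Proof.
move=> di a u v; apply: (tangent_inj di).
by rewrite tangentD tangentZ !chart_tangentK.
Qed.

Lemma vfield_decomp (Y : vfield M) i q : dom i q ->
  Y q = \sum_b Y q i 0 b *: coord_vfield i (basis b) q.
Proof.
move=> di; rewrite -[LHS](tangentK _ di) (lin_basis _ (chart_tangent_linear di)).
by [].
Qed.

Definition christoffel i x : 'rV[R]_m -> 'rV[R]_m -> 'rV[R]_m :=
  array_form (fun a b => D (param i x) (chart_tangent i (param i x) (basis a))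
                           (coord_vfield i (basis b)) i).

Lemma christoffel_smooth i : smooth_bilin (chart_image i (dom i)) (christoffel i).
Proof.
split=> [x|u v]; first exact: array_form_bilin.
have oD := mopen_dom i i.
move=> k; apply: Ck_sum => // a; apply: Ck_scale => //; first exact: Ck_cst.
apply: Ck_sum => // b; apply: Ck_scale => //; first exact: Ck_cst.
exact: (cov_smooth D (mopen_dom i) (coord_vfield_smooth i (basis a))
  (coord_vfield_smooth i (basis b)) i k).
Qed.

Lemma cov_coord_basis i p u b : dom i p ->
  D p u (coord_vfield i (basis b)) i =
  \sum_a u i 0 a *: D p (chart_tangent i p (basis a)) (coord_vfield i (basis b)) i.
Proof.
move=> di.
have LD : linear (fun u => D p u (coord_vfield i (basis b))).
  move=> c v w.
  exact: (cov_linear D c v w (mopen_dom i) di (coord_vfield_smooth i _)).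
have E : u = \sum_a u i 0 a *: chart_tangent i p (basis a).
  rewrite -[LHS](tangentK u di) (lin_basis _ (chart_tangent_linear di)).
  by [].
rewrite [in LHS]E (lin_sum LD) tangent_sum; apply: eq_bigr => a _.
by rewrite (linZ LD) tangentZ.
Qed.

(** On a chart domain [Y] is the combination of the coordinate fields with its
    components as coefficients; the Leibniz rule differentiates the components and
    leaves the Christoffel symbols. *)
Lemma covE A (Y : vfield M) i p u :
  mopen A -> A p -> dom i p -> smooth_vfield A Y ->
  D p u Y i = 'd (fun x => Y (param i x) i) (coord i p) (u i)
              + christoffel i (coord i p) (u i) (Y p i).
Proof.
move=> oA Ap di sY; pose A' := A `&` dom i.
have oA' : mopen A' by exact: mopenI (mopen_dom i).
have A'p : A' p by [].
have sf b : smooth_fun A' (fun q => Y q i 0 b) by exact: smooth_fun_component.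
have sE b : smooth_vfield A' (coord_vfield i (basis b)).
  by apply: smooth_vfield_sub (coord_vfield_smooth i _) => q [].
have sY' : smooth_vfield A' Y by apply: smooth_vfield_sub sY => q [].
have -> : D p u Y =
    D p u (fun q => \sum_b Y q i 0 b *: coord_vfield i (basis b) q).
  by apply: (cov_local u oA' A'p sY') => q [_ diq]; exact: vfield_decomp.
rewrite (cov_sum _ u oA' A'p (fun b => smooth_vfieldZ oA' (sf b) (sE b))).
rewrite tangent_sum.
under eq_bigr => b _ do
  rewrite (cov_leibniz D u oA' A'p (sf b) (sE b)) tangentD !tangentZ
          cov_coord_basis //.
rewrite big_split; congr (_ + _).
  have dY : differentiable (fun x => Y (param i x) i) (coord i p).
    by apply: smooth_differentiable (sY i) _; exact: chart_image_in.
  rewrite [RHS]rV_basis; apply: eq_bigr => b _.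
  rewrite (vderiveE u oA' (sf b) A'p di) /coord_vfield chart_tangentK //.
  by congr (_ *: _); exact: dderE (dder_coord b (dder_diff (u i) dY)).
rewrite /christoffel /array_form coordK //.
under eq_bigr do rewrite scaler_sumr.
rewrite exchange_big; apply: eq_bigr => a _; rewrite scaler_sumr.
by apply: eq_bigr => b _; rewrite !scalerA mulrC.
Qed.

Lemma cov_coord_vfield i p u v : dom i p ->
  D p u (coord_vfield i v) i = christoffel i (coord i p) (u i) v.
Proof.
move=> di; rewrite (covE u (mopen_dom i) di di (coord_vfield_smooth i v)).
rewrite /coord_vfield chart_tangentK //.
suff E : dder (fun x => chart_tangent i (param i x) v i) (coord i p) (u i) 0.
  by rewrite (dderE E) add0r.
apply: dder_near (dder_cst v _ _).
by apply: filterS (near_overlap di di) => x [dix _]; rewrite chart_tangentK.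
Qed.

End ConnectionInChart.

Section MetricInChart.
Context {R : realType} {m : nat} {M : atlas R m}.
Variable g : metric M.

Definition metric_form i x : 'rV[R]_m -> 'rV[R]_m -> R :=
  array_form (fun a b => g (param i x) (chart_tangent i (param i x) (basis a))
                           (chart_tangent i (param i x) (basis b))).

Lemma inner_bilin p : bilin (g p).
Proof.
have H w : linear (g p ^~ w) by move=> a u v; rewrite inner_linear.
by split=> // w a u v; rewrite !(inner_sym g w) H.
Qed.

Lemma metric_formE i p (u v : tangent p) : dom i p ->
  g p u v = metric_form i (coord i p) (u i) (v i).
Proof.
move=> di; rewrite /metric_form coordK //.
pose B a b := g p (chart_tangent i p a) (chart_tangent i p b).
rewrite (array_formE (B := B)) /B.
  by rewrite !tangentK.
have L := chart_tangent_linear di.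
by split=> [w|w] a y z; rewrite L ((inner_bilin p).1, (inner_bilin p).2).
Qed.

Lemma metric_form_smooth i : smooth_bilin (chart_image i (dom i)) (metric_form i).
Proof.
split=> [x|u v]; first exact: array_form_bilin.
have oD := mopen_dom i i.
move=> k; apply: Ck_sum => // a; apply: Ck_scale => //; first exact: Ck_cst.
apply: Ck_sum => // b; apply: Ck_scale => //; first exact: Ck_cst.
exact: (inner_smooth g (mopen_dom i) (coord_vfield_smooth i (basis a))
  (coord_vfield_smooth i (basis b)) i k).
Qed.

Lemma metric_form_sym i x u v : chart_image i (dom i) x ->
  metric_form i x u v = metric_form i x v u.
Proof.
move=> /chart_image_param[di _ <-].
have := inner_sym g (chart_tangent i _ u) (chart_tangent i (param i x) v).
by rewrite !(metric_formE _ _ di) !chart_tangentK.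
Qed.

Lemma metric_form_gt0 i x u : chart_image i (dom i) x -> u != 0 ->
  0 < metric_form i x u u.
Proof.
move=> /chart_image_param[di _ <-] u0; set p := param i x in di *.
have := metric_formE (chart_tangent i p u) (chart_tangent i p u) di.
rewrite chart_tangentK // => <-; apply: inner_gt0; apply: contra_neq u0 => E.
by rewrite -(chart_tangentK u di) E.
Qed.

End MetricInChart.

(** * Brackets and curvature in a chart *)

Section FieldsInChart.
Context {R : realType} {m : nat} {M : atlas R m}.
Implicit Types (p q : M) (i j : chart M) (A B : set M) (X Y Z W : vfield M).

Lemma vderive_ext A (f h : M -> R) p (u : tangent p) : mopen A -> A p ->
  smooth_fun A f -> (forall q, A q -> f q = h q) -> vderive u f = vderive u h.
Proof.
move=> oA Ap sf fh; rewrite /vderive; set j := chart_at p.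
have dj : dom j p by exact: chart_atP.
have df := smooth_fun_differentiable sf Ap dj.
apply/esym/dderE; apply: dder_near (dder_diff (u j) df).
apply: filterS (near_chart_image oA dj Ap) => x /chart_image_param[_ Aq _] /=.
by rewrite fh.
Qed.

Lemma coord_smooth i c : smooth_fun (dom i) (fun q => coord i q 0 c).
Proof.
apply: (smooth_on_chart (i := i)) => //; first exact: mopen_dom.
move=> k; apply: Ck_ext (Ck_coord c (mopen_dom i i) (Ck_id k _)).
  exact: mopen_dom.
by move=> x /chart_image_param[_ _ E] /=; rewrite E.
Qed.

Lemma vderive_coord i p (u : tangent p) c : dom i p ->
  vderive u (fun q => coord i q 0 c) = u i 0 c.
Proof.
move=> di; rewrite (vderiveE u (mopen_dom i) (@coord_smooth i c) di di).
apply: dderE; apply: dder_near (dder_coord c (dder_id (coord i p) (u i))).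
by apply: filterS (near_overlap di di) => x [_ [_ E]] /=; rewrite E.
Qed.

Local Notation cmp X i := (fun x => X (param i x) i).

Lemma component_diff A X i p : smooth_vfield A X -> A p -> dom i p ->
  differentiable (cmp X i) (coord i p).
Proof.
move=> sX Ap di; apply: smooth_differentiable (sX i) _.
exact: chart_image_in.
Qed.

Lemma vderive_component A i X p (u : tangent p) c : mopen A -> A p -> dom i p ->
  smooth_vfield A X ->
  vderive u (fun q => X q i 0 c) = 'd (cmp X i) (coord i p) (u i) 0 c.
Proof.
move=> oA Ap di sX; have oB := mopenI oA (mopen_dom i).
have sf := smooth_fun_component i c oA sX.
rewrite (vderiveE u oB sf (conj Ap di) di).
exact: dderE (dder_coord c (dder_diff (u i) (component_diff sX Ap di))).
Qed.

(** A bracket is determined by its action on the coordinate functions. *)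
Lemma lie_bracketE A i X Y W p : mopen A -> A p -> dom i p ->
  smooth_vfield A X -> smooth_vfield A Y -> lie_bracket A X Y W ->
  W p i = 'd (cmp Y i) (coord i p) (X p i) - 'd (cmp X i) (coord i p) (Y p i).
Proof.
move=> oA Ap di sX sY XYW; apply/rowP => c.
have oB := mopenI oA (mopen_dom i); have Bp : (A `&` dom i) p by [].
have sf : smooth_fun (A `&` dom i) (fun q => coord i q 0 c).
  by apply: smooth_fun_sub (@coord_smooth i c) => q [].
have := XYW _ _ oB (@subIsetl _ _ _) sf p Bp.
have E Z u : smooth_vfield A Z ->
    vderive (u : tangent p) (fun q => vderive (Z q) (fun q => coord i q 0 c))
    = 'd (cmp Z i) (coord i p) (u i) 0 c.
  move=> sZ; rewrite -(vderive_component _ _ oA Ap di sZ); apply/esym.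
  apply: (vderive_ext u oB Bp (smooth_fun_component i c oA sZ)) => q [_ diq].
  by rewrite vderive_coord.
by rewrite !E // vderive_coord // !mxE.
Qed.

(** Coordinate fields commute, since their components are constant. *)
Lemma torsion_free_sym (D : connection M) i x a b : torsion_free D ->
  chart_image i (dom i) x -> christoffel D i x a b = christoffel D i x b a.
Proof.
move=> tf /chart_image_param[di _ <-]; set p := param i x in di *.
have oD := mopen_dom i; have sE v := coord_vfield_smooth i v.
have H := lie_bracketE oD di di (sE a) (sE b) (tf _ _ _ oD (sE a) (sE b)).
have dE v w : 'd (cmp (coord_vfield i v) i) (coord i p) w = 0.
  apply: dderE; apply: dder_near (dder_cst v _ _).
  by apply: filterS (near_overlap di di) => y [diy _]; rewrite chart_tangentK.
have E0 := congr2 (fun s t : 'rV[R]_m => s - t) (dE b (coord_vfield i a p i))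
  (dE a (coord_vfield i b p i)).
have {}H : D p (coord_vfield i a p) (coord_vfield i b) i
    - D p (coord_vfield i b p) (coord_vfield i a) i = 0 - 0 := etrans H E0.
apply/eqP; rewrite -subr_eq0 -[X in _ == X](subrr 0) -H.
by rewrite !cov_coord_vfield // /coord_vfield !chart_tangentK.
Qed.

Section Covariant.
Variables (D : connection M) (A : set M) (i : chart M) (p : M).
Hypotheses (oA : mopen A) (Ap : A p) (di : dom i p).
Local Notation x := (coord i p).
Let Ux : chart_image i (dom i) x. Proof. exact: chart_image_in. Qed.

Lemma nabla_near X Y : smooth_vfield A Y -> \forall y \near x,
  'd (cmp Y i) y (X (param i y) i)
  + christoffel D i y (X (param i y) i) (Y (param i y) i)
  = nabla D X Y (param i y) i.
Proof.
move=> sY; apply: filterS (near_chart_image oA di Ap) => y.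
move=> /chart_image_param[diy Aq E].
by rewrite /nabla (covE D _ oA Aq diy sY) E.
Qed.

Lemma dder_nabla X Y w : smooth_vfield A X -> smooth_vfield A Y ->
  dder (cmp (nabla D X Y) i) x w
    ('d (fun y => 'd (cmp Y i) y (X p i)) x w + 'd (cmp Y i) x ('d (cmp X i) x w)
     + (dform (christoffel D i) x w (X p i) (Y p i)
        + christoffel D i x ('d (cmp X i) x w) (Y p i)
        + christoffel D i x (X p i) ('d (cmp Y i) x w))).
Proof.
move=> sX sY; apply: dder_near (nabla_near X sY) _.
have HX := dder_diff w (component_diff sX Ap di).
have HY := dder_diff w (component_diff sY Ap di).
have UAx : chart_image i A x by exact: chart_image_in.
apply: dderD.
  have := @dder_linapp _ _ _ _ (fun y u => 'd (cmp Y i) y u) _ _ _ _ _ _ HX.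
  rewrite /= coordK //; apply=> [y c u v|u]; first by rewrite linearP.
  exact: smooth_differentiable (smooth_diff u (sY i)) UAx.
have := dder_smooth_bilin (christoffel_smooth D i) (phi := id) Ux
  (dder_id x w) HX HY.
by rewrite /= coordK.
Qed.

(** Second derivatives of [Z] cancel by symmetry, and its first derivatives cancel
    against the term with the bracket [W]. *)
Lemma curvature_in_chart X Y Z W : smooth_vfield A X -> smooth_vfield A Y ->
  smooth_vfield A Z -> lie_bracket A X Y W ->
  (nabla D X (nabla D Y Z) p - nabla D Y (nabla D X Z) p - nabla D W Z p) i
  = curv (christoffel D i) x (X p i) (Y p i) (Z p i).
Proof.
move=> sX sY sZ XYW; have WE := lie_bracketE oA Ap di sX sY XYW.
have LG := (christoffel_smooth D i).1 x.
pose D2 (T T' : vfield M) := 'd (fun y => 'd (cmp Z i) y (T' p i)) x (T p i).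
pose D1 (T T' : vfield M) := 'd (cmp T' i) x (T p i).
have E T T' : smooth_vfield A T -> smooth_vfield A T' ->
    nabla D T (nabla D T' Z) p i =
    D2 T T' + 'd (cmp Z i) x (D1 T T')
    + (dform (christoffel D i) x (T p i) (T' p i) (Z p i)
       + christoffel D i x (D1 T T') (Z p i) + christoffel D i x (T' p i) (D1 T Z))
    + (christoffel D i x (T p i) (D1 T' Z)
       + christoffel D i x (T p i) (christoffel D i x (T' p i) (Z p i))).
  move=> sT sT'; rewrite -(bilinDr LG).
  apply: etrans (covE D (T p) oA Ap di (cov_smooth D oA sT' sZ)) _.
  exact: (congr2 (fun s t => s + christoffel D i x (T p i) t)
    (dderE (dder_nabla (T p i) sT' sZ)) (covE D (T' p) oA Ap di sZ)).
have S : D2 Y X = D2 X Y.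
  exact: smooth_diff_symmetric (X p i) (Y p i) (@oA i) (chart_image_in di Ap)
    (sZ i).
have EW := covE D (W p) oA Ap di sZ.
apply: etrans (congr2 (fun s t => s - t) (congr2 (fun s t => s - t)
  (E X Y sX sY) (E Y X sY sX)) EW) _.
have {}WE : W p i = D1 X Y - D1 Y X by [].
rewrite WE S curv.unlock (bilinBl LG) linearB; clearbody D1 D2.
move: ('d _ _ (D1 X Y)) ('d _ _ (D1 Y X)) => s t.
by apply/rowP => c; rewrite !mxE; ring.
Qed.

End Covariant.

Lemma flat_in_chart (D : connection M) : torsion_free D ->
  (flat D <-> forall i x a b c, chart_image i (dom i) x ->
     curv (christoffel D i) x a b c = 0).
Proof.
move=> tf; split=> [fD i x a b c|H A X Y Z W oA sX sY sZ XYW p Ap].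
  move=> /chart_image_param[di _ <-].
  have oD := mopen_dom i; have sE v := coord_vfield_smooth i v.
  have XYW := tf _ _ _ oD (sE a) (sE b).
  have := curvature_in_chart D oD di di (sE a) (sE b) (sE c) XYW.
  rewrite (fD _ _ _ _ _ oD (sE a) (sE b) (sE c) XYW _ di).
  by rewrite /coord_vfield !chart_tangentK.
have di := chart_atP p; apply: (tangent_inj di).
rewrite (curvature_in_chart D oA Ap di sX sY sZ XYW) H //; exact: chart_image_in.
Qed.

End FieldsInChart.

(** * Metric compatibility and parallel tensors in a chart *)

Section StructuresInChart.
Context {R : realType} {m : nat} {M : atlas R m}.
Implicit Types (p q : M) (i j : chart M) (A B : set M) (X Y Z W : vfield M).
Variable g : metric M.

Lemma nabla_metric_in_chart (D : connection M) i x a b c :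
  chart_image i (dom i) x ->
  nabla_metric D g (coord_vfield i a) (coord_vfield i b) (coord_vfield i c)
    (param i x)
  = dform (metric_form g i) x a b c - metric_form g i x (christoffel D i x a b) c
    - metric_form g i x b (christoffel D i x a c).
Proof.
move=> Ux; have [di _ xE] := chart_image_param Ux; set p := param i x in di *.
have sE v := coord_vfield_smooth i v.
have sf := inner_smooth g (mopen_dom i) (sE b) (sE c).
rewrite /nabla_metric (vderiveE _ (mopen_dom i) sf di di).
rewrite !(metric_formE g _ _ di) /nabla !cov_coord_vfield //.
rewrite /coord_vfield !chart_tangentK // xE; congr (_ - _ - _).
have dg := smooth_bilin_differentiable (metric_form_smooth g i) b c Ux.
have d := dder_diff a dg.
rewrite dform.unlock; apply: dderE; apply: dder_near d.
rewrite -xE; apply: filterS (near_overlap di di) => y [diy [_ E]] /=.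
by rewrite (metric_formE g _ _ diy) !chart_tangentK // E.
Qed.

Lemma levi_civita_in_chart (D : connection M) i x a b c : levi_civita g D ->
  chart_image i (dom i) x ->
  dform (metric_form g i) x a b c =
  metric_form g i x (christoffel D i x a b) c
  + metric_form g i x b (christoffel D i x a c).
Proof.
move=> [_ gD] Ux; have [di _ _] := chart_image_param Ux.
have sE v := coord_vfield_smooth i v.
have := gD _ _ _ _ (mopen_dom i) (sE a) (sE b) (sE c) _ di.
rewrite nabla_metric_in_chart // -addrA -opprD => /eqP.
by rewrite subr_eq0 => /eqP.
Qed.

Lemma statistical_in_chart (D : connection M) i x a b c : statistical g D ->
  chart_image i (dom i) x ->
  dform (metric_form g i) x a b c - metric_form g i x (christoffel D i x a b) c
    - metric_form g i x b (christoffel D i x a c)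
  = dform (metric_form g i) x b a c - metric_form g i x (christoffel D i x b a) c
    - metric_form g i x a (christoffel D i x b c).
Proof.
move=> [_ gD] Ux; have [di _ _] := chart_image_param Ux.
have sE v := coord_vfield_smooth i v.
have := gD _ _ _ _ (mopen_dom i) (sE a) (sE b) (sE c) _ di.
by rewrite !nabla_metric_in_chart.
Qed.

Section DifferenceTensor.
Variables D Dg : connection M.
Local Notation K := (difference_tensor D Dg).
Local Notation k i := (conn_diff (christoffel D i) (christoffel Dg i)).

Lemma difference_tensorE A i p Y Z :
  mopen A -> A p -> dom i p -> smooth_vfield A Z ->
  K Y Z p i = k i (coord i p) (Y p i) (Z p i).
Proof.
move=> oA Ap di sZ; rewrite conn_diff.unlock.
apply: etrans (congr2 (fun s t => s - t) (covE D (Y p) oA Ap di sZ)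
  (covE Dg (Y p) oA Ap di sZ)) _.
by rewrite opprD addrACA subrr add0r.
Qed.

(** The derivatives of the components of [Y] and [Z] cancel, which leaves an
    expression in the values of the fields at [p]. *)
Lemma parallel_tensor_in_chart A i p X Y Z : mopen A -> A p -> dom i p ->
  smooth_vfield A X -> smooth_vfield A Y -> smooth_vfield A Z ->
  (nabla D X (K Y Z) p - K (nabla D X Y) Z p - K Y (nabla D X Z) p) i
  = nabla_conn_diff (christoffel D i) (christoffel Dg i) (coord i p)
      (X p i) (Y p i) (Z p i).
Proof.
move=> oA Ap di sX sY sZ.
have sk : smooth_bilin (chart_image i (dom i)) (k i).
  exact: conn_diff_smooth (mopen_dom i i) (christoffel_smooth D i)
    (christoffel_smooth Dg i).
have Lk := sk.1 (coord i p).
have sK : smooth_vfield A (K Y Z).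
  by apply: smooth_vfieldB; [| exact: cov_smooth | exact: cov_smooth].
have Ux : chart_image i (dom i) (coord i p) by exact: chart_image_in.
pose dY := 'd (fun x => Y (param i x) i) (coord i p) (X p i).
pose dZ := 'd (fun x => Z (param i x) i) (coord i p) (X p i).
have EY : D p (X p) Y i = dY + christoffel D i (coord i p) (X p i) (Y p i).
  exact: covE.
have EZ : D p (X p) Z i = dZ + christoffel D i (coord i p) (X p i) (Z p i).
  exact: covE.
have dK : dder (fun x => K Y Z (param i x) i) (coord i p) (X p i)
  (dform (k i) (coord i p) (X p i) (Y p i) (Z p i)
   + k i (coord i p) dY (Z p i) + k i (coord i p) (Y p i) dZ).
  have := dder_smooth_bilin sk (phi := id) Ux (dder_id _ (X p i))
    (dder_diff _ (component_diff sY Ap di)) (dder_diff _ (component_diff sZ Ap di)).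
  rewrite /= (coordK i p di) => d; apply: dder_near d.
  apply: filterS (near_chart_image oA di Ap) => x /chart_image_param[dix Aq E].
  by have H := difference_tensorE Y oA Aq dix sZ; rewrite E in H; exact: esym H.
have E1 := covE D (X p) oA Ap di sK.
rewrite (dderE dK) (difference_tensorE Y oA Ap di sZ) in E1.
have E2 := difference_tensorE (nabla D X Y) oA Ap di sZ.
have E3 := difference_tensorE Y oA Ap di (cov_smooth D oA sX sZ).
apply: etrans (congr2 (fun s t => s - t) (congr2 (fun s t => s - t) E1 E2) E3) _.
rewrite /nabla EY EZ /nabla_conn_diff; clearbody dY dZ.
rewrite (bilinDl Lk) (bilinDr Lk).
by apply/rowP => c; rewrite !mxE; ring.
Qed.

Lemma parallel_tensorE : parallel_tensor D K <->
  forall i x a b c, chart_image i (dom i) x ->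
    nabla_conn_diff (christoffel D i) (christoffel Dg i) x a b c = 0.
Proof.
split=> [H i x a b c /chart_image_param[di _ <-]|H A X Y Z oA sX sY sZ p Ap].
  have sE v := coord_vfield_smooth i v.
  have := parallel_tensor_in_chart (mopen_dom i) di di (sE a) (sE b) (sE c).
  rewrite (H _ _ _ _ (mopen_dom i) (sE a) (sE b) (sE c) _ di).
  by rewrite /coord_vfield !chart_tangentK.
have di := chart_atP p; apply: (tangent_inj di).
rewrite (parallel_tensor_in_chart oA Ap di sX sY sZ) H //.
exact: chart_image_in.
Qed.

End DifferenceTensor.
End StructuresInChart.

(** * Lifts and the Sasakian metric *)

Section LiftsInChart.
Context {R : realType} {n : nat} {M : atlas R n}.
Implicit Types (p : M) (i : chart M).

Lemma is_derive_dder (W : normedModType R) (f : R -> W) (t : R) (d : W) :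
  is_derive t 1 f d -> dder f t 1 d.
Proof.
move=> [df <-]; have df' := (derivable1_diffP f t).1 df.
by split=> //; rewrite deriveE.
Qed.

Lemma vertical_lift_in_chart i p (xi X : tangent p) (w : tangent (tpoint xi)) :
  dom i p -> is_vertical_lift X w -> w i = row_mx 0 (X i).
Proof.
move=> di [_ /(_ i di)[_ /is_derive_dder H]]; apply: dder_unique H _.
apply: (dder_row (f := fun s : R => coord i p) (h := fun s : R => xi i + s *: X i)).
  exact: dder_cst.
apply: dder_eq.
  apply: dderD; first exact: dder_cst.
  by apply: dderZ; [exact: dder_id | exact: dder_cst].
by rewrite scale1r scaler0 addr0 add0r.
Qed.

(** Two points of the tangent bundle that are equal may lie over base points that
    are only provably equal; comparing components avoids any transport. *)
Lemma tpointE i p q (u : tangent p) (v : tangent q) : tpoint u = tpoint v ->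
  p = q /\ u i = v i.
Proof.
move=> E; split; first exact: (congr1 (fun xi : tb_point M => projT1 xi) E).
exact: (congr1 (fun xi : tb_point M => projT2 xi i) E).
Qed.

(** The equation of parallel transport at time 0 is the second component. *)
Lemma horizontal_lift_in_chart (D : connection M) i p (xi X : tangent p)
    (w : tangent (tpoint xi)) :
  dom i p -> is_horizontal_lift D X w ->
  w i = row_mx (X i) (- christoffel D i (coord i p) (X i) (xi i)).
Proof.
move=> di [e [c [dc [V [e0 [[vel _] EX] par EV [_ vw]]]]]].
have [Ec EXi] := tpointE i EX; have [_ EVi] := tpointE i EV.
have I0 : [set t : R | `|t| < e] 0 by rewrite /= normr0.
have dic : dom i (c 0) by rewrite Ec.
have [_ /(_ i dic)[_ /is_derive_dder H1]] := vel 0 I0.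
have /is_derive_dder H2 := par 0 i I0 dic.
have [_ /is_derive_dder H] := vw i di.
rewrite cov_coord_vfield // EXi EVi Ec in H2; rewrite EXi in H1.
exact: dder_unique H (dder_row H1 H2).
Qed.

(** Every tangent vector of the bundle is the sum of the horizontal lift of its
    horizontal part and the vertical lift of its vertical part. *)
Lemma sasakian_in_chart (g : metric M) (D : connection M)
    (gt : metric (tangent_bundle M)) i z A B : sasakian g D gt ->
  chart_image i (dom i) (lsubmx z) ->
  metric_form gt i z A B = metric_form g i (lsubmx z) (lsubmx A) (lsubmx B)
   + metric_form g i (lsubmx z) (rsubmx (coframe (christoffel D i) z A))
                         (rsubmx (coframe (christoffel D i) z B)).
Proof.
move=> [vl [hl [Hv [Hh Hg]]]] /chart_image_param[].
set p := param i (lsubmx z) => di _ xE.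
pose xi := chart_tangent i p (rsubmx z).
have diT : dom (a := tangent_bundle M) i (tpoint xi) by [].
have zE : coord (a := tangent_bundle M) i (tpoint xi) = z.
  rewrite -[LHS]/(row_mx (coord i p) (xi i)) xE.
  by rewrite [xi i]chart_tangentK // hsubmxK.
pose w (C : 'rV[R]_(n + n)) : tangent (tpoint xi) :=
  hl p xi (chart_tangent i p (lsubmx C))
  + vl p xi (chart_tangent i p (rsubmx (coframe (christoffel D i) z C))).
have wE C : w C i = C.
  rewrite tangentD (horizontal_lift_in_chart di (Hh p xi _)).
  rewrite (vertical_lift_in_chart di (Hv p xi _)) !chart_tangentK //.
  rewrite add_row_mx addr0 xE /coframe row_mxKr addrC addrK.
  exact: hsubmxK.
have -> : metric_form gt i z A B = gt (tpoint xi) (w A) (w B).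
  by rewrite (metric_formE gt (w A) (w B) diT) zE !wE.
have Lgt := inner_bilin gt (tpoint xi).
have gtvv X Y := let: And3 vv _ _ := Hg p xi X Y in vv.
have gthh X Y := let: And3 _ hh _ := Hg p xi X Y in hh.
have gtvh X Y := let: And3 _ _ vh := Hg p xi X Y in vh.
have gthv X Y : gt (tpoint xi) (hl p xi X) (vl p xi Y) = 0.
  by rewrite inner_sym gtvh.
rewrite /w !(bilinDl Lgt) !(bilinDr Lgt) gtvv gthh gtvh gthv addr0 add0r.
by rewrite !(metric_formE g _ _ di) !chart_tangentK // xE.
Qed.

End LiftsInChart.

Theorem theorem2p18 (R : realType) (n : nat) (M : manifold R n)
    (g : metric M) (D Dg : connection M)
    (gt : metric (tangent_bundle M)) (Dt : connection (tangent_bundle M)) :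
  statistical g D ->
  levi_civita g Dg ->
  sasakian g D gt ->
  levi_civita gt Dt ->
  (flat Dt ->
     [/\ hessian g D, flat Dg & parallel_tensor D (difference_tensor D Dg)]) /\
  ([/\ hessian g D, flat Dg & parallel_tensor D (difference_tensor D Dg)] ->
     flat Dt).
Proof.
move=> stD lcg sas lct.
have [tfD _] := stD; have [tfg _] := lcg; have [tft _] := lct.
have chartE (i : chart M) :
    (forall (z A B C : 'rV[R]_(n + n)), chart_image i (dom i) (lsubmx z) ->
       curv (christoffel Dt i) z A B C = 0) <->
    (forall x a b c, chart_image i (dom i) x ->
       [/\ curv (christoffel D i) x a b c = 0,
           curv (christoffel Dg i) x a b c = 0
         & nabla_conn_diff (christoffel D i) (christoffel Dg i) x a b c = 0]).
  have imgT : chart_image (M := tangent_bundle M) i (dom (a := tangent_bundle M) i)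
      = lsubmx @^-1` (chart_image i (dom i)) by exact: tb_overlapE.
  apply: (@sasaki_chart_flat R n (chart_image i (dom i)) (metric_form g i)
    (christoffel D i) (christoffel Dg i) (metric_form gt i) (christoffel Dt i)).
  - exact: mopen_dom.
  - exact: metric_form_smooth.
  - exact: christoffel_smooth.
  - exact: christoffel_smooth.
  - by rewrite -imgT; exact: metric_form_smooth.
  - by rewrite -imgT; exact: christoffel_smooth.
  - by move=> x u v; exact: metric_form_sym.
  - by move=> x u; exact: metric_form_gt0.
  - by move=> x a b; exact: torsion_free_sym.
  - by move=> x a b; exact: torsion_free_sym.
  - by move=> x a b c; exact: levi_civita_in_chart.
  - by move=> x a b c; exact: statistical_in_chart.
  - by move=> z A B; rewrite -imgT; exact: torsion_free_sym.
  - by move=> z A B C; rewrite -imgT; exact: levi_civita_in_chart.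
  - by move=> z A B; exact: sasakian_in_chart.
have imgT (i : chart M) (z : 'rV[R]_(n + n)) :
    chart_image (M := tangent_bundle M) i (dom (a := tangent_bundle M) i) z
    = chart_image (M := M) i (dom (a := M) i) (lsubmx z).
  have H := congr1 (fun S : set 'rV[R]_(n + n) => S z) (tb_overlapE (M := M) i i).
  exact: H.
have flatT := flat_in_chart tft.
have flatD := flat_in_chart tfD; have flatg := flat_in_chart tfg.
have parK := parallel_tensorE D Dg.
split=> [/flatT H|[[_ /flatD HD] /flatg Hg /parK HK]].
  have {}H i x a b c (Ux : chart_image i (dom i) x) :
      [/\ curv (christoffel D i) x a b c = 0, curv (christoffel Dg i) x a b c = 0
        & nabla_conn_diff (christoffel D i) (christoffel Dg i) x a b c = 0].
    by apply: (chartE i).1 => // z A B C; rewrite -imgT; exact: H.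
  split; first (split=> //).
  - by apply/flatD => i x a b c Ux; case: (H i x a b c Ux).
  - by apply/flatg => i x a b c Ux; case: (H i x a b c Ux).
  - by apply/parK => i x a b c Ux; case: (H i x a b c Ux).
apply/flatT => i z A B C; rewrite imgT; apply: (chartE i).2 => x a b c Ux.
by split; [exact: HD | exact: Hg | exact: HK].
Qed.
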